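(* Let $M\subset\mathbb{R}^{3,1}$ be a spacelike surface with a canonical normal null direction $Z$, where $Z$ is a unit spacelike parallel vector field on $\mathbb{R}^{3,1}$, and let $p\in M$. (1) If $a(p)\neq0$ and $K(p)\neq 0$, there exist two different asymptotic directions at $p$, given by $Z^\top$ and $\frac{K_N}{K}Z^\top+W$. (2) If $a(p)\neq0$ and $K(p)=0$, there exists a double asymptotic direction at $p$, given by $Z^\top$. (3) If $a(p)=0$, every (nonzero) tangent vector $u\in T_pM$ defines an asymptotic direction.
   Context: $\mathbb{R}^{3,1}$ is $\mathbb{R}^4$ with the metric $\langle\cdot,\cdot\rangle=dx_1^2+dx_2^2+dx_3^2-dx_4^2$, oriented by the canonical basis. A smooth surface $M\subset\mathbb{R}^{3,1}$ is spacelike if the induced metric is Riemannian. For a parallel (i.e. constant) vector field $Z$ write $Z=Z^\top+Z^\perp$ for its tangent and normal parts along $M$. $M$ has a canonical normal null direction with respect to $Z$ if $Z^\perp$ is a lightlike (nonzero, $\langle Z^\perp,Z^\perp\rangle=0$) normal vector field on $M$. Since $\langle Z,Z\rangle=1$, $|Z^\top|=1$. $B(X,Y)=\overline\nabla_XY-\nabla_XY$ is the second fundamental form ($\overline\nabla$, $\nabla$ the Levi-Civita connections of $\mathbb{R}^{3,1}$ and $M$), and $\langle A_\nu X,Y\rangle=\langle B(X,Y),\nu\rangle$. $W$ is the unit tangent vector field orthogonal to $Z^\top$ with $(Z^\top,W)$ positively oriented, $a=\langle B(W,W),Z^\perp\rangle$, $W'$ is the lightlike normal field with $\langle Z^\perp,W'\rangle=1$,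 and the orientation of $M$ is such that $(Z^\top,W,e_3,e_4)$ with $e_3=\frac{Z^\perp+W'}{\sqrt2}$, $e_4=\frac{Z^\perp-W'}{\sqrt2}$ is a positively oriented orthonormal frame of $\mathbb{R}^{3,1}$. $K$ is the Gauss curvature and $K_N=\langle(A_{e_3}A_{e_4}-A_{e_4}A_{e_3})(Z^\top),W\rangle$ the normal curvature. The Gauss map is $G=Z^\top\wedge W:M\to\Lambda^2\mathbb{R}^{3,1}$. For $p\in M$ define the real quadratic form $\delta:T_pM\to\mathbb{R}$, $\delta(u)=dG_p(u)\wedge dG_p(u)$, where $\Lambda^4\mathbb{R}^{3,1}\simeq\mathbb{R}$ via the canonical volume element $\simeq 1$ (the wedge of any positively oriented orthonormal basis). A nonzero $u\in T_pM$ defines an asymptotic direction at $p$ if $\delta(u)=0$; directions are considered up to nonzero scalar multiples, and in (1) the two listed directions are all of them. ''$Z^\top$ is a double asymptotic direction'' means that $Z^\top$ is a root of $\delta$ of multiplicity at least two, i.e. there is $c\in\mathbb{R}$ with $\delta(rZ^\top+sW)=c\,s^2$ for all $r,s\in\mathbb{R}$. *)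

(* Defs.v *)
From mathcomp Require Import all_boot all_order all_algebra all_fingroup.
From mathcomp Require Import ring.
From mathcomp Require Import all_classical all_reals all_analysis.

Set Implicit Arguments.
Unset Strict Implicit.
Unset Printing Implicit Defensive.

Import Order.TTheory GRing.Theory Num.Theory.
Import numFieldNormedType.Exports.

Local Open Scope classical_set_scope.
Local Open Scope ring_scope.

Section MinkowskiSpace.
Variable R : realType.
Implicit Types u v w z : 'rV[R]_4.

Definition mink u v : R :=
  u 0 0 * v 0 0 + u 0 1 * v 0 1 + u 0 2 * v 0 2 - u 0 3 * v 0 3.

Definition lightlike v := v != 0 /\ mink v v = 0.

Definition det4 u v w z : R :=
  \det (\matrix_(i < 4) [:: u; v; w; z]`_i).

(* Bivectors are encoded as antisymmetric matrices: the (i, j) entry, i < j,  *)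
(* is the coordinate along e_i /\ e_j.                                        *)
Definition wedge2 u v : 'M[R]_4 := u^T *m v - v^T *m u.

(* The product of two bivectors, read in R through e_0/\e_1/\e_2/\e_3 |-> 1.  *)
Definition wedge4 (h k : 'M[R]_4) : R :=
  h 0 1 * k 2 3 - h 0 2 * k 1 3 + h 0 3 * k 1 2
  + h 1 2 * k 0 3 - h 1 3 * k 0 2 + h 2 3 * k 0 1.

Lemma wedge4_wedge2 u v w z :
  wedge4 (wedge2 u v) (wedge2 w z) = det4 u v w z.
Proof.
pose F (i j : nat) : R := [:: u; v; w; z]`_i 0 (inord j).
have det3 (G : nat -> nat -> R) : \det (\matrix_(i < 3, j < 3) G i j) =
    G 0%N 0%N * (G 1%N 1%N * G 2%N 2%N - G 1%N 2%N * G 2%N 1%N)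
    - G 0%N 1%N * (G 1%N 0%N * G 2%N 2%N - G 1%N 2%N * G 2%N 0%N)
    + G 0%N 2%N * (G 1%N 0%N * G 2%N 1%N - G 1%N 1%N * G 2%N 0%N).
  rewrite (expand_det_row _ 0) !big_ord_recr big_ord0 /= /cofactor.
  rewrite !(expand_det_row _ 0) !big_ord_recr !big_ord0 /= /cofactor.
  by rewrite !det_mx11 !mxE /= /bump /=; ring.
have minor (j : 'I_4) : \det (row' 0 (col' j (\matrix_(i < 4, j < 4) F i j)))
    = \det (\matrix_(i < 3, k < 3) F i.+1 (bump j k)).
  by congr (\det _); apply/matrixP => i k; rewrite !mxE.
have -> : det4 u v w z = \det (\matrix_(i < 4, j < 4) F i j).
  by congr (\det _); apply/matrixP => i j; rewrite !mxE /F inord_val.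
have i0 : (inord 0 : 'I_4) = 0 by apply/val_inj; rewrite /= inordK.
have i1 : (inord 1 : 'I_4) = 1 by apply/val_inj; rewrite /= inordK.
have i2 : (inord 2 : 'I_4) = 2 by apply/val_inj; rewrite /= inordK.
have i3 : (inord 3 : 'I_4) = 3 by apply/val_inj; rewrite /= inordK.
rewrite (expand_det_row _ 0) !big_ord_recr big_ord0 /= /cofactor.
rewrite !minor !(det3 (fun i k => F i.+1 (bump _ k))) !mxE.
rewrite /F /bump /= i0 i1 i2 i3 /wedge4 /wedge2 !mxE !big_ord1 !mxE.
ring.
Qed.

End MinkowskiSpace.

Section Smoothness.
Variables (R : realType) (V W : normedModType R).

Fixpoint Ck (k : nat) (U : set V) (f : V -> W) : Prop :=
  if k is k'.+1 then
    (forall x, U x -> differentiable f x) /\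
    (forall v, Ck k' U (fun x => 'D_v f x))
  else forall x, U x -> {for x, continuous f}.

Definition smooth (U : set V) (f : V -> W) := forall k, Ck k U f.

End Smoothness.

Section Surface.
Variables (R : realType) (M : set 'rV[R]_4).

(* The last two fields say that X is a homeomorphism from U onto a relatively *)
(* open subset of M.                                                          *)
Record local_param (U : set 'rV[R]_2) (X : 'rV[R]_2 -> 'rV[R]_4) : Prop := {
  lp_open : open U;
  lp_smooth : smooth U X;
  lp_immersion : forall x, U x -> injective ('d X x);
  lp_inj : {in U &, injective X};
  lp_homeo : forall V : set 'rV[R]_2, open V -> V `<=` U ->
    exists2 O : set 'rV[R]_4, open O & X @` V = M `&` O
}.

Definition regular_surface := forall p, M p ->
  exists U X, local_param U X /\ (X @` U) p.

Definition smooth_on (V : normedModType R) (f : 'rV[R]_4 -> V) :=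
  forall U X, local_param U X -> smooth U (f \o X).

Definition curve_at (p u : 'rV[R]_4) (c : R -> 'rV[R]_4) :=
  [/\ c 0 = p, (\forall t \near (0 : R), M (c t)) & is_derive (0 : R) 1 c u].

Definition tangent (p u : 'rV[R]_4) := exists c, curve_at p u c.

Definition normal (p n : 'rV[R]_4) :=
  forall u, tangent p u -> mink n u = 0.

(* df_p(u), as the derivative of f along a curve of M through p with velocity *)
(* u; meaningful for f smooth on M and u tangent to M at p.  For maps into    *)
(* 'rV[R]_4 this is the flat ambient connection.                              *)
Definition diffM (V : normedModType R) (f : 'rV[R]_4 -> V)
    (p u : 'rV[R]_4) : V :=
  'D_1 (f \o get (curve_at p u)) (0 : R).

Definition vfield (X : 'rV[R]_4 -> 'rV[R]_4) :=
  smooth_on X /\ forall p, M p -> tangent p (X p).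

Definition nfield (N : 'rV[R]_4 -> 'rV[R]_4) :=
  smooth_on N /\ forall p, M p -> normal p (N p).

Definition spacelike :=
  forall p u, M p -> tangent p u -> u != 0 -> 0 < mink u u.

Implicit Types X Y Z : 'rV[R]_4 -> 'rV[R]_4.

(* Torsion-freeness is expressed through the action of vector fields on       *)
(* functions: (nabla_X Y - nabla_Y X) f = X (Y f) - Y (X f).                  *)
Record levi_civita
    (nabla : ('rV[R]_4 -> 'rV[R]_4) -> ('rV[R]_4 -> 'rV[R]_4) ->
             ('rV[R]_4 -> 'rV[R]_4)) : Prop := {
  lc_field : forall X Y, vfield X -> vfield Y -> vfield (nabla X Y);
  lc_addl : forall X X' Y, vfield X -> vfield X' -> vfield Y ->
    forall p, M p -> nabla (X \+ X') Y p = nabla X Y p + nabla X' Y p;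
  lc_scalel : forall (f : 'rV[R]_4 -> R) X Y,
    smooth_on f -> vfield X -> vfield Y ->
    forall p, M p -> nabla (fun q => f q *: X q) Y p = f p *: nabla X Y p;
  lc_addr : forall X Y Y', vfield X -> vfield Y -> vfield Y' ->
    forall p, M p -> nabla X (Y \+ Y') p = nabla X Y p + nabla X Y' p;
  lc_leibniz : forall (f : 'rV[R]_4 -> R) X Y,
    smooth_on f -> vfield X -> vfield Y ->
    forall p, M p -> nabla X (fun q => f q *: Y q) p =
      diffM f p (X p) *: Y p + f p *: nabla X Y p;
  lc_torsion : forall (f : 'rV[R]_4 -> R) X Y,
    smooth_on f -> vfield X -> vfield Y ->
    forall p, M p -> diffM f p (nabla X Y p - nabla Y X p) =
      diffM (fun q => diffM f q (Y q)) p (X p)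
      - diffM (fun q => diffM f q (X q)) p (Y p);
  lc_metric : forall X Y Z, vfield X -> vfield Y -> vfield Z ->
    forall p, M p -> diffM (fun q => mink (Y q) (Z q)) p (X p) =
      mink (nabla X Y p) (Z p) + mink (Y p) (nabla X Z p)
}.

Variable nabla : ('rV[R]_4 -> 'rV[R]_4) -> ('rV[R]_4 -> 'rV[R]_4) ->
                 ('rV[R]_4 -> 'rV[R]_4).

Definition sff X Y p : 'rV[R]_4 := diffM Y p (X p) - nabla X Y p.

Definition shape (nu X : 'rV[R]_4 -> 'rV[R]_4) (p : 'rV[R]_4) : 'rV[R]_4 :=
  get [set t | tangent p t /\
    forall Y, vfield Y -> mink t (Y p) = mink (sff X Y p) (nu p)].

(* [X, Y], computed on the coordinate functions of the ambient space *)
Definition bracket X Y p : 'rV[R]_4 := diffM Y p (X p) - diffM X p (Y p).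

Definition riemann X Y Z p : 'rV[R]_4 :=
  nabla X (nabla Y Z) p - nabla Y (nabla X Z) p - nabla (bracket X Y) Z p.

(* The Gauss curvature at p, for X, Y with X p, Y p a basis of the tangent    *)
(* plane.                                                                     *)
Definition gauss_curvature X Y p : R :=
  mink (riemann X Y Y p) (X p) /
  (mink (X p) (X p) * mink (Y p) (Y p) - mink (X p) (Y p) ^+ 2).

End Surface.

Section CanonicalNullDirection.
Variables (R : realType) (M : set 'rV[R]_4) (Z : 'rV[R]_4).
Implicit Types (p u v : 'rV[R]_4) (W : 'rV[R]_4 -> 'rV[R]_4).

Definition ZT p : 'rV[R]_4 :=
  get [set t | tangent M p t /\ normal M p (Z - t)].

Definition ZN p : 'rV[R]_4 := Z - ZT p.

Definition canonical_normal_null := forall p, M p -> lightlike (ZN p).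

Definition e3 (W' : 'rV[R]_4 -> 'rV[R]_4) p : 'rV[R]_4 := (Num.sqrt 2)^-1 *: (ZN p + W' p).
Definition e4 (W' : 'rV[R]_4 -> 'rV[R]_4) p : 'rV[R]_4 := (Num.sqrt 2)^-1 *: (ZN p - W' p).

(* The orientation of M is the one for which (ZT, W, e3, e4) is positively    *)
(* oriented in the ambient space; it enters only through the last field.      *)
Record adapted_frame (W W' : 'rV[R]_4 -> 'rV[R]_4) : Prop := {
  af_W : vfield M W;
  af_W_unit : forall p, M p -> mink (W p) (W p) = 1;
  af_W_orth : forall p, M p -> mink (ZT p) (W p) = 0;
  af_W' : nfield M W';
  af_W'_null : forall p, M p -> lightlike (W' p);
  af_W'_dual : forall p, M p -> mink (ZN p) (W' p) = 1;
  af_pos : forall p, M p -> 0 < det4 (ZT p) (W p) (e3 W' p) (e4 W' p)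
}.

Variable nabla : ('rV[R]_4 -> 'rV[R]_4) -> ('rV[R]_4 -> 'rV[R]_4) ->
                 ('rV[R]_4 -> 'rV[R]_4).

Definition coef_a W p : R := mink (sff M nabla W W p) (ZN p).

Definition curvK W p : R := gauss_curvature M nabla ZT W p.

Definition curvKN W (W' : 'rV[R]_4 -> 'rV[R]_4) p : R :=
  let A := shape M nabla in
  mink (A (e3 W') (A (e4 W') ZT) p - A (e4 W') (A (e3 W') ZT) p) (W p).

Definition gauss_map W p : 'M[R]_4 := wedge2 (ZT p) (W p).

Definition delta W p u : R :=
  let dG := diffM M (gauss_map W) p in wedge4 (dG u) (dG u).

Definition asymptotic W p u := [/\ tangent M p u, u != 0 & delta W p u = 0].

Definition double_asymptotic W p := asymptotic W p (ZT p) /\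
  exists c : R, forall r s : R,
    delta W p (r *: ZT p + s *: W p) = c * s ^+ 2.

Definition same_direction u v := exists2 c : R, c != 0 & v = c *: u.

End CanonicalNullDirection.

(* Main.v *)
Require Import Defs.
From mathcomp Require Import all_boot all_order all_algebra.
From mathcomp Require Import ring lra.
From mathcomp Require Import all_classical all_reals all_analysis.

(** Let [T] and [N] be the tangential and normal parts of [Z], so that
    [(T, W, N, W')] is a frame with [(T, W)] orthonormal and [(N, W')] a dual pair
    of null normals, and let [D] be the flat ambient derivative. As [Z] is
    parallel, [D T = - D N]; as [N] is null, [D N] is orthogonal to [N]. Together
    with the orthogonality relations of the frame and the fact that
    [D_T W - D_W T] is a bracket, hence tangent, this leaves three functions
    [al, be, ga] besides [a] in the structure equations ([diffTT], [diffTW],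
    [diffWT], [diffWW]):
      [D_T T = al N],            [D_T W = be N],
      [D_W T = be N + a W],      [D_W W = - a T + ga N + a W'].
    Differentiating [T /\ W] along [u = x T + y W] gives
      [dG u = (x al + y be) N /\ W + T /\ (... + y a W')],
    whose square is [2 (x al + y be) (y a)] times the volume of the frame
    ([deltaE]). The Gauss equation gives [K = al a] ([curvKE]), and the shape
    operators give [K_N = - be a] ([curvKNE]). The asymptotic directions are thus
    [y = 0], that is [T], and [x al + y be = 0], that is [K_N / K T + W] if [K] and
    [a] do not vanish; the two lines merge if [al = 0], and the form is zero if
    [a = 0].

    The analytic part makes these computations legitimate. Tangent vectors are
    velocities of curves that are merely differentiable at one point; such a curve
    lifts to a curve of parameters differentiable at that point ([curve_lift]), so
    derivatives along the surface are computed in charts, linearly in the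
    direction. Tangential parts of smooth fields are smooth, by Cramer's rule in
    the frame of a chart ([chart_projection]); hence [T], the shape operators and
    [D_X Y] are smooth. An abstract Levi-Civita connection on global fields is the
    tangential part of [D] by Koszul's argument ([mink_nabla]), and the flatness of
    [D] used in [gauss_equation] comes from the torsion axiom applied to coordinate
    functions ([torsion_commutator]). *)

Set Implicit Arguments.
Unset Strict Implicit.
Unset Printing Implicit Defensive.

Import Order.TTheory GRing.Theory Num.Theory.
Import numFieldNormedType.Exports.

Local Open Scope classical_set_scope.
Local Open Scope ring_scope.

(* These names also denote a product rule for differentials and the shape of a
   sequence of sequences. *)
Local Notation diffM := Defs.diffM.
Local Notation shape := Defs.shape.

(** * Functions of class C^k on an open set *)

(** The Taylor expansion at [x] only sees the germ at [x]; both functions then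
    have the same differential, by uniqueness of the linear part. *)
Lemma near_eq_differentiable (R : realType) (V W : normedModType R)
    (f g : V -> W) x :
  (\forall y \near x, f y = g y) -> differentiable f x -> differentiable g x.
Proof.
move=> fg df; have fgx := nbhs_singleton fg.
have gE : g \o shift x = cst (g x) + 'd f x +o_ 0 id.
  apply/eqaddoP => _/posnumP[e].
  have /eqaddoP /(_ e%:num) /(_ [gt0 of e%:num]) := diff_locally df.
  have fg0 : \forall h \near 0, f (h + x) = g (h + x).
    by move: fg; rewrite (near_shift 0); apply: filterS => h; rewrite /= subr0.
  by apply: filterS2 fg0 => h fgh; rewrite /= -fgx /= !fctE /= -fgh.
have dg : 'd g x = 'd f x :> (V -> W).
  by apply: diff_unique => //; exact: diff_continuous.
by apply/diff_locallyP; rewrite dg; split=> //; exact: diff_continuous.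
Qed.

Section SmoothFunctions.
Variables (R : realType) (V : normedModType R) (U : set V).
Hypothesis openU : open U.

Lemma near_open x (P : V -> Prop) :
  U x -> (forall y, U y -> P y) -> \forall y \near x, P y.
Proof. by move=> Ux UP; apply: filterS UP _; apply: open_nbhs_nbhs. Qed.

Lemma CkW (W : normedModType R) k (f : V -> W) : Ck k.+1 U f -> Ck k U f.
Proof.
elim: k f => [|k IHk] f /= [df Df] => [x Ux|].
  exact/differentiable_continuous/df.
by split=> // v; apply: IHk; exact: Df.
Qed.

(** Openness of [U] is what makes this true: the derivatives required by [Ck]
    depend on the values of the function around each point. *)
Lemma Ck_ext (W : normedModType R) k (f g : V -> W) :
  (forall x, U x -> f x = g x) -> Ck k U f -> Ck k U g.
Proof.
elim: k f g => [|k IHk] f g fg /= => [cf x Ux|[df Df]].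
  rewrite /prop_for /continuous_at -(fg x Ux).
  by apply: cvg_trans (cf x Ux); apply: near_eq_cvg; apply: near_open Ux _.
split=> [x Ux|v].
  by apply: near_eq_differentiable (df x Ux); apply: near_open Ux _.
apply: IHk (Df v) => x Ux; apply: near_eq_derive.
by apply: near_open Ux _.
Qed.

Lemma Ck_cst (W : normedModType R) k (w : W) : Ck k U (fun=> w).
Proof.
elim: k w => [|k IHk] w /= => [x _|]; first exact: cst_continuous.
split=> [x _|v]; first exact: differentiable_cst.
by apply: Ck_ext (IHk 0) => x _; rewrite derive_cst.
Qed.

Lemma CkD (W : normedModType R) k (f g : V -> W) :
  Ck k U f -> Ck k U g -> Ck k U (fun x => f x + g x).
Proof.
elim: k f g => [|k IHk] f g /= => [cf cg x Ux|[df Df] [dg Dg]].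
  by apply: continuousD; [exact: cf|exact: cg].
split=> [x Ux|v].
  by apply: differentiableD; [exact: df|exact: dg].
apply: Ck_ext (IHk _ _ (Df v) (Dg v)) => x Ux.
by rewrite -deriveD//; apply: diff_derivable; [exact: df|exact: dg].
Qed.

Lemma CkM k (f g : V -> R) :
  Ck k U f -> Ck k U g -> Ck k U (fun x => f x * g x).
Proof.
elim: k f g => [|k IHk] f g => [cf cg x Ux|sf sg].
  by apply: continuousM; [exact: cf|exact: cg].
have [[df Df] [dg Dg]] := (sf, sg); split=> [x Ux|v].
  by apply: differentiableM; [exact: df|exact: dg].
apply: Ck_ext (CkD (IHk _ _ (CkW sf) (Dg v)) (IHk _ _ (CkW sg) (Df v))) => x Ux.
by rewrite -[RHS]/('D_v (f * g) x) deriveM//; apply: diff_derivable;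
  [exact: df|exact: dg].
Qed.

(** By induction, since the derivative of the inverse is [- f^-1 * f^-1] times
    that of [f]. *)
Lemma CkV k (f : V -> R) :
  (forall x, U x -> f x != 0) -> Ck k U f -> Ck k U (fun x => (f x)^-1).
Proof.
move=> f0; elim: k => [|k IHk] sf => [x Ux|].
  by apply: cvgV; [exact: f0|exact: sf].
have [df Df] := sf; split=> [x Ux|v].
  by apply: differentiableV; [exact: df|exact: f0].
have sV := IHk (CkW sf).
apply: Ck_ext (CkM (CkM (Ck_cst k (-1 : R)) (CkM sV sV)) (Df v)) => x Ux.
rewrite deriveV ?f0//; last by apply: diff_derivable; exact: df.
by rewrite /GRing.scale /= expr2 invfM mulN1r.
Qed.

(** Smoothness of vectors and matrices is checked entrywise, which reduces
    products and quotients to those of scalar functions. *)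
Lemma Ck_mxP m n k (F : V -> 'M[R]_(m, n)) :
  Ck k U F <-> forall i j, Ck k U (fun x => F x i j).
Proof.
elim: k F => [|k IHk] F /=.
  split=> [cF i j x Ux|cF x Ux].
    apply: (@continuous_comp _ _ _ F (fun A : 'M[R]_(m, n) => A i j)).
      exact: cF.
    exact: coord_continuous.
  apply/cvgrPdist_le => e e0.
  have := fun i j => (cvgrPdist_le _ _).1 (cF i j x Ux) e e0.
  move=> He; near=> y.
  rewrite /Num.Def.normr /= mx_normrE (bigmax_le _ (ltW e0))//= => -[i j] _.
  rewrite !mxE /=; move: i j; near: y.
  apply: filter_forall => i; apply: filter_forall => j; exact: He.
have sumF : F = (\sum_(i < m) \sum_(j < n) (fun x => F x i j *: delta_mx i j)).
  apply/funext => x; rewrite [LHS]matrix_sum_delta fct_sumE.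
  by apply: eq_bigr => i _; rewrite fct_sumE.
have dmx x : (forall i j, differentiable (fun x => F x i j : R) x) ->
    differentiable F x.
  move=> dF; rewrite sumF.
  apply: differentiable_sum => i; apply: differentiable_sum => j.
  exact: differentiableZl.
split=> [[dF DF] i j|sF]; split=> [x Ux|v].
- apply: (@differentiable_comp _ _ _ _ F (fun A : 'M[R]_(m, n) => A i j : R)).
    exact: dF.
  exact: differentiable_coord.
- apply: Ck_ext ((IHk _).1 (DF v) i j) => x Ux.
  by rewrite derive_mx ?mxE//; apply: diff_derivable; exact: dF.
- by apply: dmx => i j; exact: (sF i j).1.
- apply/IHk => i j; apply: Ck_ext ((sF i j).2 v) => x Ux.
  rewrite derive_mx ?mxE//; apply: diff_derivable; apply: dmx => i' j'.
  exact: (sF i' j').1.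
Unshelve. all: by end_near. Qed.

Implicit Types f g : V -> R.

Lemma smooth_ext (W : normedModType R) (f g : V -> W) :
  (forall x, U x -> f x = g x) -> smooth U f -> smooth U g.
Proof. by move=> fg sf k; apply: Ck_ext fg (sf k). Qed.

Lemma smooth_cst (W : normedModType R) (w : W) : smooth U (fun=> w).
Proof. by move=> k; exact: Ck_cst. Qed.

Lemma smoothD (W : normedModType R) (f g : V -> W) :
  smooth U f -> smooth U g -> smooth U (fun x => f x + g x).
Proof. by move=> sf sg k; exact: CkD. Qed.

Lemma smoothM f g :
  smooth U f -> smooth U g -> smooth U (fun x => f x * g x).
Proof. by move=> sf sg k; exact: CkM. Qed.

Lemma smoothV f :
  (forall x, U x -> f x != 0) -> smooth U f -> smooth U (fun x => (f x)^-1).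
Proof. by move=> f0 sf k; exact: CkV. Qed.

Lemma smoothN f : smooth U f -> smooth U (fun x => - f x).
Proof.
move=> sf; apply: smooth_ext (smoothM (smooth_cst (-1 : R)) sf) => x _.
by rewrite mulN1r.
Qed.

Lemma smoothB f g :
  smooth U f -> smooth U g -> smooth U (fun x => f x - g x).
Proof. by move=> sf sg; apply: smoothD => //; exact: smoothN. Qed.

Lemma smooth_mxP m n (F : V -> 'M[R]_(m, n)) :
  smooth U F <-> forall i j, smooth U (fun x => F x i j).
Proof.
split=> [sF i j k|sF k]; first exact: ((Ck_mxP k F).1 (sF k) i j).
by apply/Ck_mxP => i j; exact: sF.
Qed.

Lemma smooth_derive (W : normedModType R) (f : V -> W) v :
  smooth U f -> smooth U (fun x => 'D_v f x).
Proof. by move=> sf k; have [_] := sf k.+1; exact. Qed.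

Lemma smooth_differentiable (W : normedModType R) (f : V -> W) x :
  smooth U f -> U x -> differentiable f x.
Proof. by move=> /(_ 1%N) [df _] /df. Qed.

End SmoothFunctions.

(** * Differentiability of lifted curves *)

(** One half of the inverse function theorem, for curves: near [y 0] the map
    [psi] is the identity up to [e * |z - y 0|], so a continuous curve [y] moves
    at most twice as fast as [psi \o y], and the difference of their increments
    is negligible. *)
Lemma is_derive_lift (R : realType) (V : normedModType R) (y : R -> V)
    (psi : V -> V) xi :
  differentiable psi (y 0) -> 'd psi (y 0) = id :> (V -> V) ->
  y @ (0 : R) --> y 0 ->
  is_derive (0 : R) 1 (psi \o y) xi -> is_derive (0 : R) 1 y xi.
Proof.
move=> dpsi dpsiE cy [dk kE].
have cvgy : (fun h : R => h^-1 *: ((y \o shift 0) (h *: 1) - y 0)) @ 0^' --> xi.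
  apply/cvgrPdist_le => e e0.
  (* |y h - y 0| <= 2 * C * |h| as soon as e1 <= 1 / 2 and d1 <= 1; the second
     entry of each minimum leaves an error of e / 2 on either side. *)
  pose C := `|xi| + 1.
  have C0 : 0 < C by rewrite ltr_wpDl.
  pose e1 := Num.min (1 / 2) (e / (4 * C)).
  pose d1 := Num.min 1 (e / 2).
  have e10 : 0 < e1 by rewrite lt_min !divr_gt0// mulr_gt0.
  have d10 : 0 < d1 by rewrite lt_min !divr_gt0// ltr01.
  have near_psi : \forall z \near y 0,
      `|psi z - psi (y 0) - (z - y 0)| <= e1 * `|z - y 0|.
    have /eqaddoP/(_ e1 e10) := diff_locally dpsi.
    rewrite dpsiE => npsi; rewrite (near_shift 0).
    apply: filterS npsi => z /=.
    by rewrite !fctE /= subr0 addrK opprD addrA.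
  have near_y : \forall h \near (0 : R),
      `|psi (y h) - psi (y 0) - (y h - y 0)| <= e1 * `|y h - y 0|.
    exact: (cy _ near_psi).
  have /cvgrPdist_le/(_ d1 d10) near_k :
      (fun h : R => h^-1 *: ((psi \o y \o shift 0) (h *: 1) - psi (y 0))) @ 0^'
      --> xi by rewrite -kE; exact: dk.
  near=> h.
  have h0 : h != 0 by near: h; exact: nbhs_dnbhs_neq.
  have scl1 : h *: (1 : R) + 0 = h by rewrite addr0 [LHS]mulr1.
  have quot (a : V) r : `|xi - h^-1 *: a| <= r <-> `|a - h *: xi| <= r * `|h|.
    rewrite -ler_pdivrMr ?normr_gt0// mulrC -normfV -normrZ scalerBr scalerA.
    by rewrite mulVf// scale1r distrC.
  have /quot kh : `|xi - h^-1 *: (psi (y h) - psi (y 0))| <= d1.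
    by rewrite -[in psi (y h)]scl1; near: h.
  have yh : `|psi (y h) - psi (y 0) - (y h - y 0)| <= e1 * `|y h - y 0|.
    by near: h; exact: (nbhs_dnbhs near_y).
  rewrite /= scl1; apply/quot.
  set a := psi (y h) - psi (y 0) in kh yh; set d := y h - y 0 in yh *.
  have dx : `|d - h *: xi| <= `|a - d| + `|a - h *: xi|.
    by rewrite (distrC a d) -[d - _](subrKA a) ler_normD.
  have dn : `|d| <= `|d - h *: xi| + `|xi| * `|h|.
    by rewrite mulrC -normrZ -{1}(subrK (h *: xi) d) ler_normD.
  have hn : 0 <= `|h| by [].
  have xin : 0 <= `|xi| by [].
  have dnn : 0 <= `|d| by [].
  have e1l : e1 <= 1 / 2 by rewrite ge_min lexx.
  have d1l : d1 <= 1 by rewrite ge_min lexx.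
  have d1e : d1 <= e / 2 by rewrite ge_min lexx orbT.
  have e1e : e1 * (2 * C) <= e / 2.
    rewrite -ler_pdivlMr ?mulr_gt0// (le_trans (_ : _ <= e / (4 * C)))//.
      by rewrite ge_min lexx orbT.
    by rewrite le_eqVlt; apply/orP; left; apply/eqP; field; rewrite gt_eqF.
  have d1h : d1 * `|h| <= `|h| by rewrite ler_piMl.
  have e1d : e1 * `|d| <= 1 / 2 * `|d| by rewrite ler_wpM2r.
  have dC : `|d| <= 2 * C * `|h|.
    by rewrite /C; move: dx dn kh yh; lra.
  have : e1 * `|d| <= e1 * (2 * C) * `|h|.
    by rewrite -mulrA ler_wpM2l// ltW.
  have : e1 * (2 * C) * `|h| <= e / 2 * `|h| by rewrite ler_wpM2r.
  have : d1 * `|h| <= e / 2 * `|h| by rewrite ler_wpM2r.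
  by move: dx kh yh; lra.
by split; [apply/cvg_ex; exists xi|exact: cvg_lim].
Unshelve. all: by end_near. Qed.

Lemma differentiable_mulmxr (R : realType) m n (B : 'M[R]_(m, n)) (v : 'rV[R]_m) :
  differentiable (fun u => u *m B) v.
Proof.
have -> : (fun u : 'rV[R]_m => u *m B) =
    \sum_(i < m) (fun u : 'rV[R]_m => u 0 i *: row i B).
  by apply/funext => u; rewrite fct_sumE mulmx_sum_row.
apply: differentiable_sum => i.
apply: differentiableZl.
exact: differentiable_coord.
Qed.

Lemma diff_mulmxr (R : realType) m n (B : 'M[R]_(m, n)) (v : 'rV[R]_m) :
  'd (fun u => u *m B) v = (fun u => u *m B) :> ('rV[R]_m -> 'rV[R]_n).
Proof.
apply: (diff_lin (f := mulmxr B)) => u.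
exact/differentiable_continuous/differentiable_mulmxr.
Qed.

(** * Curves and tangent vectors in a chart *)

Lemma is_derive_comp1 (R : realType) (V W : normedModType R) (f : V -> W)
    (y : R -> V) xi :
  differentiable f (y 0) -> is_derive (0 : R) 1 y xi ->
  is_derive (0 : R) 1 (f \o y) ('d f (y 0) xi).
Proof.
move=> df [dy yE].
have /derivable1_diffP dy' := dy.
have dfy : differentiable (f \o y) (0 : R) by exact: differentiable_comp.
split; first exact/derivable1_diffP.
by rewrite deriveE// diff_comp//= -yE deriveE.
Qed.

Section Chart.
Variables (R : realType) (M : set 'rV[R]_4).
Variables (U : set 'rV[R]_2) (phi : 'rV[R]_2 -> 'rV[R]_4) (x : 'rV[R]_2).
Hypotheses (chart : local_param M U phi) (Ux : U x).

Lemma chart_image y : U y -> M (phi y).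
Proof.
move=> Uy; have [Q _ imQ] := lp_homeo chart (lp_open chart) (@subset_refl _ _).
have : (phi @` U) (phi y) by exists y.
by rewrite imQ => -[].
Qed.

Lemma chart_differentiable : differentiable phi x.
Proof. exact: smooth_differentiable (lp_smooth chart) Ux. Qed.

Lemma chart_nbhs (N : set 'rV[R]_2) : nbhs x N ->
  \forall q \near phi x, M q -> exists y, [/\ U y, N y & phi y = q].
Proof.
move=> nN; pose N' := U `&` interior N.
have oN' : open N' by apply: openI; [exact: lp_open chart|exact: open_interior].
have [Q oQ imQ] := lp_homeo chart oN' (@subIsetl _ _ _).
have Qx : Q (phi x).
  have : (phi @` N') (phi x) by exists x => //; split.
  by rewrite imQ => -[].
apply: filterS (open_nbhs_nbhs (conj oQ Qx)) => q Qq Mq.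
have [y [Uy Ny] <-] : (phi @` N') q by rewrite imQ.
by exists y; split=> //; exact: nbhs_singleton Ny.
Qed.

(** A linear retraction of the ambient space onto the parameter plane; composed
    with [phi] it has the identity as differential at [x]. *)
Lemma chart_left_inverse : exists L : 'M[R]_(4, 2),
  forall v, 'd phi x v *m L = v.
Proof.
have free : row_free ('J phi x).
  apply: inj_row_free => v.
  rewrite mul_rV_lin1 => dv0; apply: (lp_immersion chart Ux).
  by rewrite dv0 linear0.
exists (pinvmx ('J phi x)) => v.
by rewrite -(mul_rV_lin1 ('d phi x)) -mulmxA mulmxVp// mulmx1.
Qed.

(** The homeomorphism property of the chart lifts a curve of [M] to a continuous
    curve [y] of parameters. Its image under the left inverse [L] of the
    differential is [L \o c], which is differentiable at 0, hence so is [y] by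
    [is_derive_lift]. *)
Lemma curve_lift u c : curve_at M (phi x) u c ->
  exists y xi, [/\ y 0 = x, \forall t \near (0 : R), phi (y t) = c t,
    is_derive (0 : R) 1 y xi & u = 'd phi x xi].
Proof.
move=> [c0 Mc dc].
pose lift_of t := [set z | U z /\ phi z = c t].
pose y t := get (lift_of t).
have yP t z : U z -> phi z = c t -> y t = z.
  move=> Uz phiz; have [Uy phiy] : lift_of t (y t) by apply: (@getI _ _ z).
  by apply: (lp_inj chart); rewrite ?inE// phiy.
have y0 : y 0 = x by apply: yP => //.
have cc : c @ (0 : R) --> phi x.
  rewrite -c0; apply: differentiable_continuous; apply/derivable1_diffP.
  exact: ex_derive.
have near_y (N : set 'rV[R]_2) : nbhs x N ->
    \forall t \near (0 : R), N (y t) /\ phi (y t) = c t.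
  move=> /chart_nbhs/cc nN; apply: filterS2 Mc nN => t Mct /(_ Mct)[z [Uz Nz zc]].
  by rewrite (yP t z).
have cy : y @ (0 : R) --> y 0.
  by rewrite y0 => N /near_y; apply: filterS => t [].
have phiyE : \forall t \near (0 : R), phi (y t) = c t.
  by apply: filterS (near_y setT filterT) => t [].
have [L LK] := chart_left_inverse.
have dphi := chart_differentiable.
pose psi := (fun u : 'rV[R]_4 => u *m L) \o phi.
have dpsi : differentiable psi (y 0).
  by rewrite y0; apply: differentiable_comp => //; exact: differentiable_mulmxr.
have dpsiE : 'd psi (y 0) = id :> ('rV[R]_2 -> 'rV[R]_2).
  rewrite y0 diff_comp//; last exact: differentiable_mulmxr.
  by rewrite diff_mulmxr; apply/funext => v /=; rewrite LK.
have dy : is_derive (0 : R) 1 y (u *m L).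
  apply: (is_derive_lift dpsi dpsiE cy).
  have := is_derive_comp1 (differentiable_mulmxr L (c 0)) dc.
  rewrite diff_mulmxr => cL.
  by apply: near_eq_is_derive cL; apply: filterS phiyE => t; rewrite /psi /= => ->.
exists y, (u *m L); split=> //.
have := is_derive_comp1 (_ : differentiable phi (y 0)) dy.
rewrite y0 => /(_ dphi) dphiy.
rewrite -[LHS](@derive_val _ _ _ _ _ _ _ dc) -(near_eq_derive _ phiyE).
exact: (@derive_val _ _ _ _ _ _ _ dphiy).
Qed.

Lemma curve_of_chart xi :
  curve_at M (phi x) ('d phi x xi) (fun t => phi (x + t *: xi)).
Proof.
have line : is_derive (0 : R) 1 (fun t : R => x + t *: xi) xi.
  have [dl dlE] := is_diffD (is_diff_cst x (0 : R)) (is_diff_scalel 0 xi).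
  split; first exact/derivable1_diffP.
  have -> : (fun t : R => x + t *: xi) = cst x + *:%R^~ xi by [].
  rewrite deriveE// dlE.
  by rewrite !fctE /= add0r scale1r.
split; first by rewrite scale0r addr0.
  have cline : (fun t : R => x + t *: xi) @ (0 : R) --> x.
    have /derivable1_diffP/differentiable_continuous :=
      @ex_derive _ _ _ _ _ _ _ line.
    by rewrite /prop_for /continuous_at scale0r addr0.
  have nU : nbhs x U by apply: open_nbhs_nbhs; split=> //; exact: lp_open chart.
  have : \forall t \near (0 : R), U (x + t *: xi) := cline U nU.
  by apply: filterS => t; exact: chart_image.
have x0 : x + 0 *: xi = x by rewrite scale0r addr0.
have dphi0 : differentiable phi (x + 0 *: xi).
  by rewrite x0; exact: chart_differentiable.
by have := is_derive_comp1 dphi0 line; rewrite x0.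
Qed.

Lemma tangent_chart u : tangent M (phi x) u <-> exists xi, u = 'd phi x xi.
Proof.
split=> [[c /curve_lift[y [xi [_ _ _ ->]]]]|[xi ->]]; first by exists xi.
by exists (fun t => phi (x + t *: xi)); exact: curve_of_chart.
Qed.

(** The derivative of [f] along the curve picked by [diffM] is read in the chart,
    hence does not depend on that curve and is linear in the direction. *)
Lemma diffM_chart (W : normedModType R) (f : 'rV[R]_4 -> W) xi :
  differentiable (f \o phi) x ->
  is_derive (0 : R) 1 (f \o get (curve_at M (phi x) ('d phi x xi)))
    ('d (f \o phi) x xi).
Proof.
move=> df; set c := get _.
have /curve_lift[y [xi' [y0 phiy dy dxi]]] : curve_at M (phi x) ('d phi x xi) c.
  by apply: (@getI _ _ (fun t => phi (x + t *: xi))); exact: curve_of_chart.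
rewrite (lp_immersion chart Ux dxi) -y0 in df *.
by apply: near_eq_is_derive (is_derive_comp1 df dy); apply: filterS phiy => t /= ->.
Qed.

End Chart.

(** * The Minkowski product and its derivative *)

Section Minkowski.
Variable R : realType.
Implicit Types (u v w : 'rV[R]_4) (a : R).

Lemma minkC u v : mink u v = mink v u.
Proof. by rewrite /mink; ring. Qed.

Lemma minkDl u v w : mink (u + v) w = mink u w + mink v w.
Proof. by rewrite /mink !mxE; ring. Qed.

Lemma minkZl a u v : mink (a *: u) v = a * mink u v.
Proof. by rewrite /mink !mxE; ring. Qed.

Lemma minkNl u v : mink (- u) v = - mink u v.
Proof. by rewrite -scaleN1r minkZl mulN1r. Qed.

Lemma minkDr u v w : mink w (u + v) = mink w u + mink w v.
Proof. by rewrite !(minkC w) minkDl. Qed.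

Lemma minkZr a u v : mink v (a *: u) = a * mink v u.
Proof. by rewrite !(minkC v) minkZl. Qed.

Lemma minkNr u v : mink v (- u) = - mink v u.
Proof. by rewrite !(minkC v) minkNl. Qed.

Lemma mink0l u : mink 0 u = 0.
Proof. by rewrite -(scale0r 0) minkZl mul0r. Qed.

Lemma mink0r u : mink u 0 = 0.
Proof. by rewrite minkC mink0l. Qed.

Definition minkE :=
  (minkDl, minkDr, minkNl, minkNr, minkZl, minkZr, mink0l, mink0r).

End Minkowski.

Section CurveDerivatives.
Variable R : realType.

Lemma is_derive_mxP m n (F : R -> 'M[R]_(m, n)) t D :
  is_derive t (1 : R) F D <-> forall i j, is_derive t (1 : R) (fun s => F s i j) (D i j).
Proof.
split=> [[dF FD] i j|dF].
  split; first exact: ((derivable_mxP F t 1).1 dF i j).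
  by rewrite -FD derive_mx// mxE.
have dF' : derivable F t 1.
  by apply/derivable_mxP => i j; exact: (@ex_derive _ _ _ _ _ _ _ (dF i j)).
split=> //; rewrite derive_mx//; apply/matrixP => i j; rewrite mxE.
exact: (@derive_val _ _ _ _ _ _ _ (dF i j)).
Qed.

Lemma is_derive_mul (f g : R -> R) t df dg :
  is_derive t (1 : R) f df -> is_derive t (1 : R) g dg ->
  is_derive t (1 : R) (fun s => f s * g s) (df * g t + f t * dg).
Proof.
move=> df' dg'; have := is_deriveM df' dg'.
by rewrite /GRing.scale /= addrC (mulrC (g t)).
Qed.

Lemma is_derive_mink (x y : R -> 'rV[R]_4) t dx dy :
  is_derive t (1 : R) x dx -> is_derive t (1 : R) y dy ->
  is_derive t (1 : R) (fun s => mink (x s) (y s)) (mink dx (y t) + mink (x t) dy).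
Proof.
move=> /is_derive_mxP Dx /is_derive_mxP Dy.
have D i := is_derive_mul (Dx 0 i) (Dy 0 i).
have Dsum : is_derive t (1 : R) (fun s => mink (x s) (y s)) _ :=
  is_deriveB (is_deriveD (is_deriveD (D 0) (D 1)) (D 2)) (D 3).
by apply: (is_derive_eq Dsum); rewrite /mink; ring.
Qed.

Lemma is_derive_wedge2 (x y : R -> 'rV[R]_4) t dx dy :
  is_derive t (1 : R) x dx -> is_derive t (1 : R) y dy ->
  is_derive t (1 : R) (fun s => wedge2 (x s) (y s))
    (wedge2 dx (y t) + wedge2 (x t) dy).
Proof.
move=> /is_derive_mxP Dx /is_derive_mxP Dy; apply/is_derive_mxP => i j.
have -> : (fun s => wedge2 (x s) (y s) i j) =
    (fun s => x s 0 i * y s 0 j - y s 0 i * x s 0 j).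
  by apply/funext => s; rewrite /wedge2 !mxE !big_ord1 !mxE.
have Dsub : is_derive t (1 : R) (fun s => x s 0 i * y s 0 j - y s 0 i * x s 0 j) _ :=
  is_deriveB (is_derive_mul (Dx 0 i) (Dy 0 j)) (is_derive_mul (Dy 0 i) (Dx 0 j)).
by apply: (is_derive_eq Dsub); rewrite /wedge2 !mxE !big_ord1 !mxE; ring.
Qed.

End CurveDerivatives.

Section SmoothMink.
Variables (R : realType) (V : normedModType R) (U : set V).
Hypothesis openU : open U.

Lemma smooth_mink (x y : V -> 'rV[R]_4) :
  smooth U x -> smooth U y -> smooth U (fun s => mink (x s) (y s)).
Proof.
move=> /(smooth_mxP openU) sx /(smooth_mxP openU) sy.
have s i := smoothM openU (sx 0 i) (sy 0 i).
by apply: smoothB => //; do 2?apply: smoothD => //.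
Qed.

Lemma smoothZ m n (f : V -> R) (x : V -> 'M[R]_(m, n)) :
  smooth U f -> smooth U x -> smooth U (fun s => f s *: x s).
Proof.
move=> sf /(smooth_mxP openU) sx; apply/(smooth_mxP openU) => i j.
by apply: (smooth_ext openU) (smoothM openU sf (sx i j)) => s _; rewrite mxE.
Qed.

End SmoothMink.

(** * Directional derivatives along a surface *)

Section SurfaceCalculus.
Variables (R : realType) (M : set 'rV[R]_4).
Hypotheses (M_surface : regular_surface M) (M_spacelike : spacelike M).

Lemma surface_chart p : M p -> exists U phi x,
  [/\ local_param M U phi, U x & p = phi x].
Proof. by move=> /M_surface[U [phi [lp [x Ux <-]]]]; exists U, phi, x. Qed.

Lemma tangent_lin p a b u v : M p ->
  tangent M p u -> tangent M p v -> tangent M p (a *: u + b *: v).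
Proof.
move=> /surface_chart[U [phi [x [lp Ux ->]]]].
move=> /(tangent_chart lp Ux)[xi ->] /(tangent_chart lp Ux)[eta ->].
by apply/(tangent_chart lp Ux); exists (a *: xi + b *: eta); rewrite linearD !linearZ.
Qed.

Lemma tangentB p u v : M p ->
  tangent M p u -> tangent M p v -> tangent M p (u - v).
Proof.
move=> Mp tu tv; rewrite -[u]scale1r -scaleN1r; exact: tangent_lin.
Qed.

Lemma tangent_normal_eq0 p u : M p -> tangent M p u -> normal M p u -> u = 0.
Proof.
move=> Mp tu nu; apply/eqP; apply: contraPT (nu u tu) => u0 uu.
by have := M_spacelike Mp tu u0; rewrite uu ltxx.
Qed.

Section DirectionalDerivative.
Variables (p u : 'rV[R]_4).
Hypotheses (Mp : M p) (Tu : tangent M p u).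
Let c := get (curve_at M p u).

Lemma curve_atP : curve_at M p u c.
Proof. by have [c' /getI] := Tu. Qed.

Lemma diffM_derive (V : normedModType R) (f : 'rV[R]_4 -> V) :
  smooth_on M f -> is_derive (0 : R) 1 (f \o c) (diffM M f p u).
Proof.
move=> sf; have [U [phi [x [lp Ux px]]]] := surface_chart Mp.
move: Tu; rewrite px => /(tangent_chart lp Ux)[xi uxi].
have df := smooth_differentiable (sf _ _ lp) Ux.
have := diffM_chart lp Ux xi df; rewrite -px -uxi -/c => dfc.
by rewrite /diffM -/c (@derive_val _ _ _ _ _ _ _ dfc).
Qed.

Lemma diffM_eq (V : normedModType R) (f : 'rV[R]_4 -> V) l :
  is_derive (0 : R) 1 (f \o c) l -> diffM M f p u = l.
Proof. by move=> df; rewrite /diffM -/c (@derive_val _ _ _ _ _ _ _ df). Qed.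

Lemma diffM_ext (V : normedModType R) (f g : 'rV[R]_4 -> V) :
  (forall q, M q -> f q = g q) -> diffM M f p u = diffM M g p u.
Proof.
move=> fg; have [_ Mc _] := curve_atP.
by apply: near_eq_derive; apply: filterS Mc => t /fg.
Qed.

Lemma diffM_cst (V : normedModType R) (v : V) : diffM M (fun=> v) p u = 0.
Proof. by apply: diffM_eq; exact: is_derive_cst. Qed.

Lemma diffMD (V : normedModType R) (f g : 'rV[R]_4 -> V) :
  smooth_on M f -> smooth_on M g ->
  diffM M (fun q => f q + g q) p u = diffM M f p u + diffM M g p u.
Proof.
by move=> sf sg; apply: diffM_eq; exact: is_deriveD (diffM_derive sf) (diffM_derive sg).
Qed.

Lemma diffMN (V : normedModType R) (f : 'rV[R]_4 -> V) :
  smooth_on M f -> diffM M (fun q => - f q) p u = - diffM M f p u.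
Proof. by move=> sf; apply: diffM_eq; exact: is_deriveN (diffM_derive sf). Qed.

Lemma diffM_coord m n (F : 'rV[R]_4 -> 'M[R]_(m, n)) i j : smooth_on M F ->
  diffM M (fun q => F q i j) p u = diffM M F p u i j.
Proof.
by move=> sF; apply: diffM_eq; have /is_derive_mxP := diffM_derive sF; exact.
Qed.

Lemma diffM_mink (X Y : 'rV[R]_4 -> 'rV[R]_4) : smooth_on M X -> smooth_on M Y ->
  diffM M (fun q => mink (X q) (Y q)) p u =
  mink (diffM M X p u) (Y p) + mink (X p) (diffM M Y p u).
Proof.
move=> sX sY; apply: diffM_eq; have [c0 _ _] := curve_atP.
by have := is_derive_mink (diffM_derive sX) (diffM_derive sY); rewrite /= c0.
Qed.

Lemma diffM_wedge2 (X Y : 'rV[R]_4 -> 'rV[R]_4) : smooth_on M X -> smooth_on M Y ->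
  diffM M (fun q => wedge2 (X q) (Y q)) p u =
  wedge2 (diffM M X p u) (Y p) + wedge2 (X p) (diffM M Y p u).
Proof.
move=> sX sY; apply: diffM_eq; have [c0 _ _] := curve_atP.
by have := is_derive_wedge2 (diffM_derive sX) (diffM_derive sY); rewrite /= c0.
Qed.

(** Meant for the constant products of the frame fields: each of them relates two
    components of the derivatives of the frame. *)
Lemma diffM_mink_cst (X Y : 'rV[R]_4 -> 'rV[R]_4) k :
  smooth_on M X -> smooth_on M Y -> (forall q, M q -> mink (X q) (Y q) = k) ->
  mink (diffM M X p u) (Y p) = - mink (X p) (diffM M Y p u).
Proof.
move=> sX sY XYk; apply/eqP; rewrite -addr_eq0 -diffM_mink//.
by rewrite (diffM_ext XYk) diffM_cst.
Qed.

Lemma diffM_id : diffM M id p u = u.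
Proof. by apply: diffM_eq; have [] := curve_atP. Qed.

End DirectionalDerivative.

Lemma diffM_lin (V : normedModType R) (f : 'rV[R]_4 -> V) p a b u v :
  smooth_on M f -> M p -> tangent M p u -> tangent M p v ->
  diffM M f p (a *: u + b *: v) = a *: diffM M f p u + b *: diffM M f p v.
Proof.
move=> sf /surface_chart[U [phi [x [lp Ux ->]]]].
have df := smooth_differentiable (sf _ _ lp) Ux.
have E xi : diffM M f (phi x) ('d phi x xi) = 'd (f \o phi) x xi.
  by apply: diffM_eq; exact: (diffM_chart lp Ux xi df).
move=> /(tangent_chart lp Ux)[xi ->] /(tangent_chart lp Ux)[eta ->].
by rewrite -!linearZ -linearD !E linearD !linearZ.
Qed.

Section SmoothOn.
Implicit Types (X Y : 'rV[R]_4 -> 'rV[R]_4).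

Lemma smooth_on_ext (V : normedModType R) (f g : 'rV[R]_4 -> V) :
  (forall q, M q -> f q = g q) -> smooth_on M f -> smooth_on M g.
Proof.
move=> fg sf U phi lp; apply: (smooth_ext (lp_open lp)) (sf _ _ lp) => y Uy.
by apply: fg; exact: (chart_image lp).
Qed.

Lemma smooth_on_cst (V : normedModType R) (v : V) : smooth_on M (fun=> v).
Proof. by move=> U phi lp; apply: smooth_cst; exact: lp_open lp. Qed.

Lemma smooth_onD (V : normedModType R) (f g : 'rV[R]_4 -> V) :
  smooth_on M f -> smooth_on M g -> smooth_on M (fun q => f q + g q).
Proof.
move=> sf sg U phi lp.
by apply: (smoothD (lp_open lp)) (sf _ _ lp) (sg _ _ lp).
Qed.

Lemma smooth_onZ (f : 'rV[R]_4 -> R) X :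
  smooth_on M f -> smooth_on M X -> smooth_on M (fun q => f q *: X q).
Proof.
move=> sf sX U phi lp.
by apply: (smoothZ (lp_open lp)) (sf _ _ lp) (sX _ _ lp).
Qed.

Lemma smooth_onN X : smooth_on M X -> smooth_on M (fun q => - X q).
Proof.
move=> sX; apply: smooth_on_ext (smooth_onZ (smooth_on_cst (-1 : R)) sX) => q _.
by rewrite scaleN1r.
Qed.

Lemma smooth_onB X Y :
  smooth_on M X -> smooth_on M Y -> smooth_on M (fun q => X q - Y q).
Proof. by move=> sX sY; apply: smooth_onD => //; exact: smooth_onN. Qed.

Lemma smooth_on_mxP m n (F : 'rV[R]_4 -> 'M[R]_(m, n)) :
  smooth_on M F <-> forall i j, smooth_on M (fun q => F q i j).
Proof.
split=> [sF i j U phi lp|sF U phi lp].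
  exact: ((smooth_mxP (lp_open lp) (F \o phi)).1 (sF _ _ lp) i j).
by apply/(smooth_mxP (lp_open lp)) => i j; exact: sF.
Qed.

Lemma smooth_on_id : smooth_on M id.
Proof. by move=> U phi lp; exact: lp_smooth lp. Qed.

End SmoothOn.
End SurfaceCalculus.

(** * Tangential parts of smooth fields *)

Section GramDeterminant.
Variable R : realType.
Implicit Types v w n : 'rV[R]_4.

Definition gram v w : R := mink v v * mink w w - mink v w * mink v w.

(** The Gram determinant of a spacelike plane is positive because it is, up to a
    positive factor, the square of the vector [o] of the Gram-Schmidt process. *)
Lemma gram_orth v w :
  let o := mink v v *: w - mink v w *: v in mink o o = mink v v * gram v w.
Proof. by rewrite /= !minkE (minkC w v) /gram; ring. Qed.

(** Cramer's rule: the coordinate along [v] of the orthogonal projection of [n]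
    on the plane spanned by [v] and [w]. *)
Definition gram_coord n v w : R :=
  (mink w w * mink n v - mink v w * mink n w) / gram v w.

Lemma gramC v w : gram v w = gram w v.
Proof. by rewrite /gram (minkC w v); ring. Qed.

Lemma gram_coord_orth n v w : gram v w != 0 ->
  let r := n - (gram_coord n v w *: v + gram_coord n w v *: w) in
  mink r v = 0 /\ mink r w = 0.
Proof.
rewrite /= !minkE (minkC w v) /gram_coord (gramC w v) /gram (minkC w v).
move: (mink v v) (mink v w) (mink w w) (mink n v) (mink n w) => a b c e f g0.
by split; field.
Qed.

Lemma mink_comb_eq0 a b n v w :
  mink n v = 0 -> mink n w = 0 -> mink n (a *: v + b *: w) = 0.
Proof. by move=> nv nw; rewrite minkDr !minkZr nv nw !mulr0 addr0. Qed.

End GramDeterminant.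

Section GramProjection.
Variables (R : realType) (M : set 'rV[R]_4).
Hypothesis M_spacelike : spacelike M.
Variables (U : set 'rV[R]_2) (phi : 'rV[R]_2 -> 'rV[R]_4).
Hypothesis chart : local_param M U phi.

Let d (i : 'I_2) y := 'D_(delta_mx 0 i) phi y.
Lemma chart_frame (W : normedModType R) (f : 'rV[R]_2 -> W) x (xi : 'rV[R]_2) :
  differentiable f x ->
  'd f x xi = xi 0 0 *: 'D_(delta_mx 0 0) f x + xi 0 1 *: 'D_(delta_mx 0 1) f x.
Proof.
move=> df; rewrite !deriveE// -!linearZ -linearD; congr ('d f x _).
rewrite {1}(row_sum_delta xi) !big_ord_recl big_ord0 addr0.
by congr (_ + xi 0 _ *: delta_mx _ _); apply/val_inj.
Qed.

Lemma smooth_chart_frame i : smooth U (d i).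
Proof. exact: smooth_derive (lp_smooth chart). Qed.

Lemma chart_gram_gt0 x : U x -> 0 < gram (d 0 x) (d 1 x).
Proof.
move=> Ux; have dphi := chart_differentiable chart Ux.
have dE i : d i x = 'd phi x (delta_mx 0 i) by rewrite /d deriveE.
have pos xi : xi != 0 -> 0 < mink ('d phi x xi) ('d phi x xi).
  move=> xi0; apply: M_spacelike (chart_image chart Ux) _ _.
    by apply/(tangent_chart chart Ux); exists xi.
  by rewrite -(linear0 ('d phi x)) (inj_eq (lp_immersion chart Ux)).
have lin2 (f : {linear 'rV[R]_2 -> 'rV[R]_4}) (a b : R) v w :
  f (a *: w - b *: v) = a *: f w - b *: f v by rewrite linearB !linearZ.
have nz (a b : R) : a != 0 ->
    a *: delta_mx 0 1 - b *: delta_mx 0 0 != 0 :> 'rV[R]_2.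
  move=> a0; apply/eqP => /matrixP/(_ 0 1); rewrite !mxE /= mulr1 mulr0 subr0.
  exact/eqP.
have g0 : 0 < mink (d 0 x) (d 0 x).
  rewrite dE; apply: pos; apply/eqP => /matrixP/(_ 0 0).
  by rewrite !mxE /=; apply/eqP; rewrite oner_eq0.
have := pos _ (nz _ (mink (d 0 x) (d 1 x)) (lt0r_neq0 g0)).
have dphiE a b : 'd phi x (a *: delta_mx 0 1 - b *: delta_mx 0 0) =
    a *: d 1 x - b *: d 0 x :> 'rV[R]_4.
  by rewrite !dE; exact: lin2.
by rewrite dphiE gram_orth pmulr_rgt0.
Qed.

(** The tangential part of a smooth field along [M] is smooth: its coordinates in
    the frame of the chart are rational functions of smooth ones, whose
    denominator is the Gram determinant. *)
Lemma chart_projection (F : 'rV[R]_4 -> 'rV[R]_4) : smooth_on M F ->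
  exists xi : 'rV[R]_2 -> 'rV[R]_2, smooth U xi /\
    forall y, U y -> normal M (phi y) (F (phi y) - 'd phi y (xi y)).
Proof.
move=> sF; have oU := lp_open chart.
have sd := smooth_chart_frame.
have sm (X Y : 'rV[R]_2 -> 'rV[R]_4) :
    smooth U X -> smooth U Y -> smooth U (fun y => mink (X y) (Y y)).
  exact: smooth_mink.
have scoord i j : (forall y, U y -> 0 < gram (d i y) (d j y)) ->
    smooth U (fun y => gram_coord (F (phi y)) (d i y) (d j y)).
  move=> gij; have sFphi : smooth U (F \o phi) by exact: sF.
  apply: smoothM => //.
    by apply: smoothB => //; apply: smoothM => //; exact: sm.
  apply: smoothV => //; first by move=> y /gij; exact: lt0r_neq0.
  by apply: smoothB => //; apply: smoothM => //; exact: sm.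
pose xi y : 'rV[R]_2 := \row_j
  (if j == 0 then gram_coord (F (phi y)) (d 0 y) (d 1 y)
   else gram_coord (F (phi y)) (d 1 y) (d 0 y)).
exists xi; split=> [|y Uy].
  apply/smooth_mxP => // i j.
  under eq_fun do rewrite mxE.
  case: (j == 0); first exact: (scoord 0 1 chart_gram_gt0).
  by apply: (scoord 1 0) => y Uy; rewrite gramC; exact: chart_gram_gt0.
have dphi := chart_differentiable chart Uy.
have [r0 r1] := gram_coord_orth (F (phi y)) (lt0r_neq0 (chart_gram_gt0 Uy)).
move=> u /(tangent_chart chart Uy)[eta ->].
have dphiE (a : 'rV[R]_2) :
    'd phi y a = a 0 0 *: d 0 y + a 0 1 *: d 1 y :> 'rV[R]_4.
  exact: chart_frame.
rewrite (dphiE eta) dphiE [xi y 0 0]mxE [xi y 0 1]mxE /=.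
exact: mink_comb_eq0 r0 r1.
Qed.

End GramProjection.

Section TangentialParts.
Variables (R : realType) (M : set 'rV[R]_4).
Hypotheses (M_surface : regular_surface M) (M_spacelike : spacelike M).

Lemma tangential_part p v : M p -> exists t, tangent M p t /\ normal M p (v - t).
Proof.
move=> /(surface_chart M_surface)[U [phi [x [lp Ux ->]]]].
have [xi [_ /(_ x Ux) nxi]] := chart_projection M_spacelike lp (smooth_on_cst v).
exists ('d phi x (xi x)); split=> //.
by apply/(tangent_chart lp Ux); exists (xi x).
Qed.

Lemma tangential_part_unique p v t t' : M p ->
  tangent M p t -> normal M p (v - t) ->
  tangent M p t' -> normal M p (v - t') -> t = t'.
Proof.
move=> Mp Tt nt Tt' nt'; apply/eqP; rewrite -subr_eq0; apply/eqP.
apply: (tangent_normal_eq0 M_spacelike Mp); first exact: tangentB.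
by move=> u Tu; move: (nt u Tu) (nt' u Tu); rewrite !minkE; lra.
Qed.

(** The local coordinates of a smooth tangent field are smooth (take [F := P]),
    which makes its action on functions computable in the chart. *)
Lemma chart_lift (F P : 'rV[R]_4 -> 'rV[R]_4) U phi : local_param M U phi ->
  smooth_on M F ->
  (forall q, M q -> tangent M q (P q) /\ normal M q (F q - P q)) ->
  exists xi : 'rV[R]_2 -> 'rV[R]_2, smooth U xi /\
    forall y, U y -> P (phi y) = 'd phi y (xi y).
Proof.
move=> lp sF PP; have [xi [sxi nxi]] := chart_projection M_spacelike lp sF.
exists xi; split=> // y Uy; have Mq := chart_image lp Uy.
have [TP nP] := PP _ Mq.
apply: (tangential_part_unique Mq TP nP) (nxi y Uy).
by apply/(tangent_chart lp Uy); exists (xi y).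
Qed.

Lemma vfield_tangential_part (F P : 'rV[R]_4 -> 'rV[R]_4) : smooth_on M F ->
  (forall q, M q -> tangent M q (P q) /\ normal M q (F q - P q)) -> vfield M P.
Proof.
move=> sF PP; split=> [U phi lp|q /PP[]//].
have [xi [sxi Pxi]] := chart_lift lp sF PP; have oU := lp_open lp.
apply: (smooth_ext oU (f := fun y => xi y 0 0 *: 'D_(delta_mx 0 0) phi y +
    xi y 0 1 *: 'D_(delta_mx 0 1) phi y)) => [y Uy|].
  by rewrite /= Pxi// chart_frame//; exact: (chart_differentiable lp).
have /(smooth_mxP oU) sxi' := sxi.
by apply: smoothD => //; apply: smoothZ => //; apply: smooth_derive;
  exact: (lp_smooth lp).
Qed.

Lemma smooth_on_diffM m n (F : 'rV[R]_4 -> 'M[R]_(m, n)) X :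
  smooth_on M F -> vfield M X -> smooth_on M (fun q => diffM M F q (X q)).
Proof.
move=> sF [sX tX] U phi lp; have oU := lp_open lp.
have [q Mq|xi [sxi Xxi]] := chart_lift lp sX (P := X).
  by split; [exact: tX|move=> u _; rewrite subrr mink0l].
apply: (smooth_ext oU (f := fun y => xi y 0 0 *: 'D_(delta_mx 0 0) (F \o phi) y +
    xi y 0 1 *: 'D_(delta_mx 0 1) (F \o phi) y)) => [y Uy|].
  have dF := smooth_differentiable (sF _ _ lp) Uy.
  rewrite /= Xxi// -chart_frame//.
  by rewrite (diffM_eq (diffM_chart lp Uy (xi y) dF)).
have /(smooth_mxP oU) sxi' := sxi.
by apply: smoothD => //; apply: smoothZ => //; apply: smooth_derive; exact: sF.
Qed.

End TangentialParts.

(** * The Levi-Civita connection and the Gauss equation *)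

Section LeviCivita.
Variables (R : realType) (M : set 'rV[R]_4).
Hypotheses (M_surface : regular_surface M) (M_spacelike : spacelike M).
Variable nabla : ('rV[R]_4 -> 'rV[R]_4) -> ('rV[R]_4 -> 'rV[R]_4) ->
                 ('rV[R]_4 -> 'rV[R]_4).
Hypothesis nabla_LC : levi_civita M nabla.
Implicit Types X Y Z : 'rV[R]_4 -> 'rV[R]_4.

Local Notation D X Y := (fun q => diffM M Y q (X q)).

Lemma nabla_tangent X Y p : vfield M X -> vfield M Y -> M p ->
  tangent M p (nabla X Y p).
Proof. by move=> vX vY Mp; exact: (lc_field nabla_LC vX vY).2. Qed.

Lemma tangent_torsion X Y p : vfield M X -> vfield M Y -> M p ->
  tangent M p (nabla X Y p - nabla Y X p).
Proof. by move=> vX vY Mp; apply: tangentB => //; exact: nabla_tangent. Qed.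

(** The ambient derivative [D] is flat: the torsion axiom, applied to the
    coordinates of [F], contains the symmetry of second derivatives. *)
Lemma torsion_commutator X Y (F : 'rV[R]_4 -> 'rV[R]_4) p :
  vfield M X -> vfield M Y -> smooth_on M F -> M p ->
  diffM M F p (nabla X Y p - nabla Y X p) =
  diffM M (D Y F) p (X p) - diffM M (D X F) p (Y p).
Proof.
move=> vX vY sF Mp; apply/rowP => i; have [[sX tX] [sY tY]] := (vX, vY).
have sFi : smooth_on M (fun q => F q 0 i) by exact: ((smooth_on_mxP _ _).1 sF 0 i).
have DE X' : vfield M X' -> forall q, M q ->
    diffM M (fun q => F q 0 i) q (X' q) = (D X' F q) 0 i.
  by move=> [_ tX'] q Mq; rewrite -(diffM_coord M_surface Mq (tX' q Mq)).
rewrite -(diffM_coord M_surface Mp (tangent_torsion vX vY Mp))//.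
rewrite (lc_torsion nabla_LC sFi vX vY Mp) [RHS]mxE [X in _ = _ + X]mxE.
rewrite (diffM_ext (tX p Mp) (DE Y vY)) (diffM_ext (tY p Mp) (DE X vX)).
rewrite (diffM_coord M_surface Mp (tX p Mp)); last exact: smooth_on_diffM.
by rewrite (diffM_coord M_surface Mp (tY p Mp))//; exact: smooth_on_diffM.
Qed.

(** The case [F = id] of [torsion_commutator]. *)
Lemma torsion_bracket X Y p : vfield M X -> vfield M Y -> M p ->
  nabla X Y p - nabla Y X p = bracket M X Y p.
Proof.
move=> vX vY Mp; have Ttor := tangent_torsion vX vY Mp.
have := torsion_commutator vX vY (@smooth_on_id _ M) Mp.
rewrite (diffM_id Ttor) => ->.
have DidE X' : vfield M X' -> forall q, M q -> D X' id q = X' q.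
  by move=> [_ tX'] q Mq; rewrite diffM_id//; exact: tX'.
by rewrite /bracket (diffM_ext (vX.2 p Mp) (DidE Y vY))
  (diffM_ext (vY.2 p Mp) (DidE X vX)).
Qed.

Lemma vfield_bracket X Y : vfield M X -> vfield M Y -> vfield M (bracket M X Y).
Proof.
move=> vX vY; have [sXY _] := lc_field nabla_LC vX vY.
have [sYX _] := lc_field nabla_LC vY vX; split=> [|q Mq].
  by apply: smooth_on_ext (smooth_onB sXY sYX) => q Mq; exact: torsion_bracket.
by rewrite -torsion_bracket//; exact: tangent_torsion.
Qed.

(** Koszul's uniqueness argument: the defect [e X Y Z] between [nabla] and the
    tangential part of the ambient derivative is symmetric in [X, Y] (both have
    the same torsion) and antisymmetric in [Y, Z] (both are metric), hence is
    zero. *)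
Lemma mink_nabla X Y Z p : vfield M X -> vfield M Y -> vfield M Z -> M p ->
  mink (nabla X Y p) (Z p) = mink (diffM M Y p (X p)) (Z p).
Proof.
move=> vX vY vZ Mp.
pose e X Y Z := mink (nabla X Y p) (Z p) - mink (diffM M Y p (X p)) (Z p).
have esym X' Y' Z' : vfield M X' -> vfield M Y' -> e X' Y' Z' = e Y' X' Z'.
  move=> vX' vY'; have := congr1 (fun v => mink v (Z' p)) (torsion_bracket vX' vY' Mp).
  rewrite /bracket !minkDl !minkNl -/(e X' Y' Z') /e.
  by move: (mink _ _) (mink _ _) (mink _ _) (mink _ _) => *; lra.
have eanti X' Y' Z' : vfield M X' -> vfield M Y' -> vfield M Z' ->
    e X' Y' Z' = - e X' Z' Y'.
  move=> vX' vY' vZ'; have := lc_metric nabla_LC vX' vY' vZ' Mp.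
  rewrite (diffM_mink M_surface Mp (vX'.2 p Mp) vY'.1 vZ'.1).
  rewrite (minkC (Y' p)) (minkC (Y' p)) /e.
  by move: (mink _ _) (mink _ _) (mink _ _) (mink _ _) => *; lra.
have : e X Y Z = 0.
  have := esym _ _ Z vX vY; have := esym _ _ X vY vZ; have := esym _ _ Y vZ vX.
  have := eanti _ _ _ vX vY vZ; have := eanti _ _ _ vY vZ vX.
  have := eanti _ _ _ vZ vX vY.
  move: (e X Y Z) (e Y Z X) (e Z X Y) (e X Z Y) (e Y X Z) (e Z Y X) => *; lra.
by rewrite /e => /eqP; rewrite subr_eq0 => /eqP.
Qed.

Lemma sff_normal X Y Z p : vfield M X -> vfield M Y -> vfield M Z -> M p ->
  mink (sff M nabla X Y p) (Z p) = 0.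
Proof. by move=> vX vY vZ Mp; rewrite /sff minkDl minkNl mink_nabla// subrr. Qed.

Lemma sffC X Y p : vfield M X -> vfield M Y -> M p ->
  sff M nabla X Y p = sff M nabla Y X p.
Proof.
move=> vX vY Mp; have /eqP := torsion_bracket vX vY Mp.
rewrite /bracket subr_eq => /eqP nablaXY; rewrite /sff nablaXY.
by rewrite opprD opprB addrA addrCA subrr addr0.
Qed.

Lemma diffM_nabla_sff X Y p : diffM M Y p (X p) = nabla X Y p + sff M nabla X Y p.
Proof. by rewrite /sff addrC subrK. Qed.

(** Differentiating [<nabla_V X, Y> = <D_V X, Y>] along [U] moves a second
    derivative of the surface into the flat ambient space. *)
Lemma mink_nabla2 U V X Y p : vfield M U -> vfield M V -> vfield M X ->
  vfield M Y -> M p ->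
  mink (nabla U (nabla V X) p) (Y p) =
  mink (diffM M (D V X) p (U p)) (Y p) + mink (sff M nabla V X p) (sff M nabla U Y p).
Proof.
move=> vU vV vX vY Mp; have TU := vU.2 p Mp.
have vVX := lc_field nabla_LC vV vX; have vUY := lc_field nabla_LC vU vY.
have sD : smooth_on M (D V X) by apply: smooth_on_diffM => //; exact: vX.1.
have : diffM M (fun q => mink (nabla V X q) (Y q)) p (U p) =
    diffM M (fun q => mink (D V X q) (Y q)) p (U p).
  by apply: diffM_ext => // q Mq; rewrite mink_nabla.
rewrite (diffM_mink M_surface Mp TU vVX.1 vY.1).
rewrite (diffM_mink M_surface Mp TU sD vY.1) (mink_nabla vU vVX vY Mp).
rewrite (diffM_nabla_sff V X) (diffM_nabla_sff U Y).
rewrite [in X in _ = X -> _]minkDl [in X in _ = X -> _](minkDr _ _ (sff M nabla V X p)).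
rewrite (sff_normal vV vX vUY Mp).
move: (mink _ _) (mink _ _) (mink _ _) (mink _ _) => *; lra.
Qed.

(** [mink_nabla2] turns the two second covariant derivatives into ambient ones,
    which cancel against the bracket term by flatness; the products of second
    fundamental forms remain. *)
Lemma gauss_equation X Y p : vfield M X -> vfield M Y -> M p ->
  mink (riemann M nabla X Y Y p) (X p) =
  mink (sff M nabla X X p) (sff M nabla Y Y p)
  - mink (sff M nabla X Y p) (sff M nabla X Y p).
Proof.
move=> vX vY Mp; have sY := vY.1.
have flat : mink (nabla (bracket M X Y) Y p) (X p) =
    mink (diffM M (D Y Y) p (X p)) (X p) - mink (diffM M (D X Y) p (Y p)) (X p).
  rewrite (mink_nabla (vfield_bracket vX vY) vY vX Mp).
  by rewrite -(torsion_bracket vX vY Mp) torsion_commutator// minkDl minkNl.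
have DXX := mink_nabla2 vX vY vY vX Mp.
have DYX := mink_nabla2 vY vX vY vX Mp.
rewrite (minkC (sff M nabla Y Y p)) in DXX; rewrite (sffC vY vX Mp) in DYX.
have -> : mink (riemann M nabla X Y Y p) (X p) =
    mink (nabla X (nabla Y Y) p) (X p) - mink (nabla Y (nabla X Y) p) (X p)
    - mink (nabla (bracket M X Y) Y p) (X p).
  by rewrite /riemann !minkDl !minkNl.
rewrite flat DXX DYX.
have cancel (a b c e : R) : a + b - (c + e) - (a - c) = b - e by ring.
exact: cancel.
Qed.

Lemma mink_sff_nfield X Y nu p : vfield M X -> vfield M Y -> nfield M nu -> M p ->
  mink (sff M nabla X Y p) (nu p) = mink (diffM M Y p (X p)) (nu p).
Proof.
move=> vX vY [_ nnu] Mp; rewrite /sff minkDl minkNl.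
by rewrite (minkC (nabla X Y p)) nnu ?subr0//; exact: nabla_tangent.
Qed.

(** The tangential part of [- D_X nu] is a solution of the equations that define
    the shape operator (Weingarten), because [mink (Y q) (nu q)] vanishes along
    [M]. *)
Lemma shapeP X nu p : vfield M X -> nfield M nu -> M p ->
  tangent M p (shape M nabla nu X p) /\
  forall Y, vfield M Y ->
    mink (shape M nabla nu X p) (Y p) = mink (sff M nabla X Y p) (nu p).
Proof.
move=> vX vnu Mp; have [snu nnu] := vnu.
have [t [Tt nt]] := tangential_part M_surface M_spacelike (- diffM M nu p (X p)) Mp.
pose dual_to_sff := [set t | tangent M p t /\ forall Y, vfield M Y ->
  mink t (Y p) = mink (sff M nabla X Y p) (nu p)].
suff dual_t : dual_to_sff t by exact: (getI dual_t).
split=> // Y vY.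
have [sY tY] := vY.
have orth q : M q -> mink (Y q) (nu q) = 0.
  by move=> Mq; rewrite minkC nnu//; exact: tY.
rewrite (mink_sff_nfield vX vY vnu Mp).
rewrite (diffM_mink_cst M_surface Mp (vX.2 p Mp) sY snu orth).
have := nt _ (tY p Mp); rewrite minkDl !minkNl (minkC (Y p)).
by move: (mink _ _) (mink _ _) => *; lra.
Qed.

End LeviCivita.

(** * Linear algebra of null frames *)

Section NullFrameAlgebra.
Variable R : realType.
Implicit Types t w n m v : 'rV[R]_4.

(** Lowering the index of [v] gives a column killed by the invertible matrix with
    rows [t, w, e, f]. *)
Lemma mink_nondegenerate (t w e f v : 'rV[R]_4) : det4 t w e f != 0 ->
  mink t v = 0 -> mink w v = 0 -> mink e v = 0 -> mink f v = 0 -> v = 0.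
Proof.
rewrite /det4; set A := (\matrix_(i < 4) _) => detA tv wv ev fv.
pose flat : 'cV[R]_4 := \col_j (if j == 3 then - v 0 j else v 0 j).
have Aflat : A *m flat = 0.
  have rowE (u : 'rV[R]_4) : \sum_j u 0 j * flat j 0 = mink u v.
    rewrite !big_ord_recl big_ord0 !mxE /mink addr0 mulrN !addrA.
    by congr (_ + u 0 _ * v 0 _ + u 0 _ * v 0 _ - u 0 _ * v 0 _); apply/val_inj.
  apply/colP => i; rewrite !mxE.
  under eq_bigr => j _ do rewrite [A i j]mxE.
  by case: i => [[|[|[|[|//]]]] ?] /=; rewrite rowE.
have flat0 : flat = 0.
  have uA : A \in unitmx by rewrite unitmxE unitfE.
  by rewrite -[flat](mulKmx uA) Aflat mulmx0.
apply/rowP => j; have := congr1 (fun B : 'cV[R]_4 => B j 0) flat0.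
by rewrite !mxE; case: ifP => // _ /eqP; rewrite oppr_eq0 => /eqP.
Qed.

Lemma wedge2Dl u v w : wedge2 (u + v) w = wedge2 u w + wedge2 v w :> 'M[R]_4.
Proof. by apply/matrixP => i j; rewrite !mxE !big_ord1 !mxE; ring. Qed.

Lemma wedge2Zl a v w : wedge2 (a *: v) w = a *: wedge2 v w :> 'M[R]_4.
Proof. by apply/matrixP => i j; rewrite !mxE !big_ord1 !mxE; ring. Qed.

Lemma wedge2C v w : wedge2 v w = - wedge2 w v :> 'M[R]_4.
Proof. by rewrite /wedge2 opprB. Qed.

Lemma wedge2vv v : wedge2 v v = 0 :> 'M[R]_4.
Proof. by rewrite /wedge2 subrr. Qed.

Lemma wedge2Dr u v w : wedge2 w (u + v) = wedge2 w u + wedge2 w v :> 'M[R]_4.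
Proof. by rewrite !(wedge2C w) wedge2Dl opprD. Qed.

Lemma wedge2Zr a v w : wedge2 w (a *: v) = a *: wedge2 w v :> 'M[R]_4.
Proof. by rewrite !(wedge2C w) wedge2Zl scalerN. Qed.

Lemma wedge4_swap n w t m :
  wedge4 (wedge2 n w) (wedge2 t m) = - wedge4 (wedge2 t w) (wedge2 n m).
Proof. by rewrite /wedge4 /wedge2 !mxE !big_ord1 !mxE; ring. Qed.

Lemma wedge4Nr (h k : 'M[R]_4) : wedge4 h (- k) = - wedge4 h k.
Proof. by rewrite /wedge4 !mxE; ring. Qed.

(** The shape of the square of [dG u]: after expansion only the two bivectors
    [n /\ w] and [t /\ m] share no factor. *)
Lemma wedge4_square t w n m (x y z k l : R) :
  let h := wedge2 (x *: n + y *: w) w + wedge2 t (z *: n + k *: t + l *: m) in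
  wedge4 h h = 2 * x * l * wedge4 (wedge2 n w) (wedge2 t m).
Proof.
rewrite /= !(wedge2Dl, wedge2Dr, wedge2Zl, wedge2Zr) !wedge2vv !scaler0 !addr0.
by rewrite /wedge4 /wedge2 !mxE !big_ord1 !mxE; ring.
Qed.

Definition null_frame t w n m :=
  [/\ mink t t = 1, mink w w = 1, mink n m = 1 & mink t w = 0] /\
  [/\ mink n n = 0, mink m m = 0,
     mink n t = 0 /\ mink n w = 0 & mink m t = 0 /\ mink m w = 0].

Lemma null_frame_residual t w n m v x y z k : null_frame t w n m ->
  mink v t = x -> mink v w = y -> mink v m = z -> mink v n = k ->
  let r := v - (x *: t + y *: w + z *: n + k *: m) in
  [/\ mink t r = 0, mink w r = 0, mink n r = 0 & mink m r = 0].
Proof.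
move=> [[tt ww nm tw] [nn mm [nt nw] [mt mw]]] vt vw vm vn.
rewrite /= !(minkC _ (v - _)) !minkE vt vw vm vn tt ww nm tw nn mm nt nw mt mw.
rewrite (minkC w) (minkC t n) (minkC t m) (minkC w n) (minkC w m) (minkC m n).
by rewrite tw nt mt nw mw nm; split; ring.
Qed.

End NullFrameAlgebra.

(** * The structure equations of the canonical frame *)

Section CanonicalNullFrame.
Variables (R : realType) (M : set 'rV[R]_4) (Z : 'rV[R]_4).
Variable nabla : ('rV[R]_4 -> 'rV[R]_4) -> ('rV[R]_4 -> 'rV[R]_4) ->
                 ('rV[R]_4 -> 'rV[R]_4).
Variables W W' : 'rV[R]_4 -> 'rV[R]_4.
Hypotheses (M_surface : regular_surface M) (M_spacelike : spacelike M).
Hypotheses (Z_unit : mink Z Z = 1) (Z_null : canonical_normal_null M Z).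
Hypotheses (nabla_LC : levi_civita M nabla) (frame : adapted_frame M Z W W').

Local Notation T := (ZT M Z).
Local Notation N := (ZN M Z).

Lemma ZTP p : M p -> tangent M p (T p) /\ normal M p (Z - T p).
Proof.
move=> Mp; have [t tP] := tangential_part M_surface M_spacelike Z Mp.
pose parts := [set t | tangent M p t /\ normal M p (Z - t)].
exact: (@getI _ parts t tP).
Qed.

(** The axioms of [nabla] speak of smooth tangent fields, so [T] has to be shown
    to be one. *)
Lemma vfield_ZT : vfield M T.
Proof.
exact: (vfield_tangential_part M_surface M_spacelike (smooth_on_cst Z) ZTP).
Qed.

Lemma nfield_ZN : nfield M N.
Proof.
split=> [|p /ZTP[]//]; apply: smooth_onB; first exact: smooth_on_cst.
exact: vfield_ZT.1.
Qed.

Lemma nfield_comb a b n n' :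
  nfield M n -> nfield M n' -> nfield M (fun p => a *: n p + b *: n' p).
Proof.
move=> [sn nn] [sn' nn']; split=> [|p Mp u Tu].
  by apply: smooth_onD; apply: smooth_onZ => //; exact: smooth_on_cst.
by rewrite minkDl !minkZl nn// nn'// !mulr0 addr0.
Qed.

Local Notation s := ((Num.sqrt 2)^-1 : R).

Lemma sqrt2Vsq : s * s = 1 / 2.
Proof. by rewrite -invfM -expr2 sqr_sqrtr// mul1r. Qed.

Lemma e3E p : e3 M Z W' p = s *: N p + s *: W' p.
Proof. by rewrite /e3 scalerDr. Qed.

Lemma e4E p : e4 M Z W' p = s *: N p + - s *: W' p.
Proof. by rewrite /e4 scalerBr scaleNr. Qed.

Lemma nfield_e3 : nfield M (e3 M Z W').
Proof.
have -> : e3 M Z W' = fun p => s *: N p + s *: W' p.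
  by apply/funext => p; exact: e3E.
by apply: nfield_comb; [exact: nfield_ZN|exact: af_W' frame].
Qed.

Lemma nfield_e4 : nfield M (e4 M Z W').
Proof.
have -> : e4 M Z W' = fun p => s *: N p + - s *: W' p.
  by apply/funext => p; exact: e4E.
by apply: nfield_comb; [exact: nfield_ZN|exact: af_W' frame].
Qed.

Lemma wedge2_e3e4 p : wedge2 (e3 M Z W' p) (e4 M Z W' p) = - wedge2 (N p) (W' p).
Proof.
have expand (n m : 'rV[R]_4) (r k : R) :
    wedge2 (r *: n + r *: m) (r *: n + - k *: m) = - (r * (r + k)) *: wedge2 n m.
  rewrite wedge2Dl !wedge2Dr !wedge2Zl !wedge2Zr !wedge2vv (wedge2C m n).
  by apply/matrixP => i j; rewrite !mxE; ring.
rewrite e3E e4E expand mulrDr sqrt2Vsq.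
have -> : 1 / 2 + 1 / 2 = 1 :> R by field.
by rewrite scaleN1r.
Qed.

Section Pairings.
Variable p : 'rV[R]_4.
Hypothesis Mp : M p.

Lemma minkNT : mink (N p) (T p) = 0.
Proof. by have [TT nN] := ZTP Mp; exact: nN. Qed.

Lemma minkNN : mink (N p) (N p) = 0.
Proof. by have [] := Z_null Mp. Qed.

Lemma minkTT : mink (T p) (T p) = 1.
Proof.
have := minkNN; have := minkNT; have := Z_unit.
rewrite /ZN !minkDl !minkNl !minkDr !minkNr (minkC (T p) Z).
by move: (mink Z Z) (mink Z _) (mink _ _) => *; lra.
Qed.

Lemma minkTW : mink (T p) (W p) = 0.
Proof. exact: af_W_orth frame _ Mp. Qed.

Lemma minkWW : mink (W p) (W p) = 1.
Proof. exact: af_W_unit frame _ Mp. Qed.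

Lemma minkNW : mink (N p) (W p) = 0.
Proof. by apply: nfield_ZN.2 => //; exact: (af_W frame).2. Qed.

Lemma minkW'T : mink (W' p) (T p) = 0.
Proof. by apply: (af_W' frame).2 => //; exact: vfield_ZT.2. Qed.

Lemma minkW'W : mink (W' p) (W p) = 0.
Proof. by apply: (af_W' frame).2 => //; exact: (af_W frame).2. Qed.

Lemma minkW'W' : mink (W' p) (W' p) = 0.
Proof. by have [] := af_W'_null frame Mp. Qed.

Lemma minkNW' : mink (N p) (W' p) = 1.
Proof. exact: af_W'_dual frame _ Mp. Qed.

Lemma ZT_null_frame : null_frame (T p) (W p) (N p) (W' p).
Proof.
by do ![split]; [exact: minkTT|exact: minkWW|exact: minkNW'|exact: minkTW
  |exact: minkNN|exact: minkW'W'|exact: minkNT|exact: minkNW|exact: minkW'T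
  |exact: minkW'W].
Qed.

Lemma frame_expansion v x y z k :
  mink v (T p) = x -> mink v (W p) = y -> mink v (W' p) = z -> mink v (N p) = k ->
  v = x *: T p + y *: W p + z *: N p + k *: W' p.
Proof.
move=> vT vW vW' vN; apply/eqP; rewrite -subr_eq0; apply/eqP.
have /= := null_frame_residual ZT_null_frame vT vW vW' vN.
set r := v - _ => -[rT rW rN rW'].
apply: (mink_nondegenerate (lt0r_neq0 (af_pos frame Mp)) rT rW).
  by rewrite e3E minkDl !minkZl rN rW' !mulr0 addr0.
by rewrite e4E minkDl !minkZl rN rW' !mulr0 addr0.
Qed.

Lemma tangent_expansion u : tangent M p u ->
  u = mink u (T p) *: T p + mink u (W p) *: W p.
Proof.
move=> Tu; rewrite {1}(frame_expansion (erefl _) (erefl (mink u (W p))) (z := 0) (k := 0)).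
- by rewrite !scale0r !addr0.
- by rewrite minkC; apply: (af_W' frame).2.
- by rewrite minkC; apply: nfield_ZN.2.
Qed.

End Pairings.

(** The normal curvature iterates the shape operator, so its first application
    has to be a smooth field: it is the tangential part of [- D_X nu]. *)
Lemma vfield_shape X nu : vfield M X -> nfield M nu ->
  vfield M (shape M nabla nu X).
Proof.
move=> vX vnu; have [snu nnu] := vnu.
have sD : smooth_on M (fun q => - diffM M nu q (X q)).
  by apply: smooth_onN; exact: smooth_on_diffM.
apply: (vfield_tangential_part M_surface M_spacelike sD) => q Mq.
have [Tsh shY] := shapeP M_surface M_spacelike nabla_LC vX vnu Mq.
split=> // u /(tangent_expansion Mq) ->.
have pair0 Y : vfield M Y -> mink (- diffM M nu q (X q) - shape M nabla nu X q) (Y q) = 0.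
  move=> vY; have [sY tY] := vY.
  rewrite minkDl !minkNl (shY _ vY) (mink_sff_nfield nabla_LC vX vY vnu Mq).
  have orth r : M r -> mink (Y r) (nu r) = 0.
    by move=> Mr; rewrite minkC nnu//; exact: tY.
  rewrite (diffM_mink_cst M_surface Mq (vX.2 q Mq) sY snu orth) (minkC (Y q)).
  by rewrite opprK addNr.
by rewrite minkDr !minkZr !pair0 ?mulr0 ?addr0//; [exact: af_W frame|exact: vfield_ZT].
Qed.

Section StructureEquations.
Variable p : 'rV[R]_4.
Hypothesis Mp : M p.

Let vT := vfield_ZT.
Let vW := af_W frame.
Let nN := nfield_ZN.
Let nW' := af_W' frame.

Local Notation al := (mink (diffM M T p (T p)) (W' p)).
Local Notation be := (mink (diffM M W p (T p)) (W' p)).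
Local Notation ga := (mink (diffM M W p (W p)) (W' p)).
Local Notation a := (coef_a M Z nabla W p).

Section AlongVector.
Variable u : 'rV[R]_4.
Hypothesis Tu : tangent M p u.

Lemma diffM_ZN : diffM M N p u = - diffM M T p u.
Proof.
rewrite -[X in diffM M X p u]/(fun q => Z + - T q).
rewrite (diffMD M_surface Mp Tu (smooth_on_cst Z) (smooth_onN vT.1)).
by rewrite diffM_cst add0r (diffMN M_surface Mp Tu vT.1).
Qed.

Lemma mink_diff_unit X k : smooth_on M X -> (forall q, M q -> mink (X q) (X q) = k) ->
  mink (diffM M X p u) (X p) = 0.
Proof.
move=> sX Xk; have := diffM_mink_cst M_surface Mp Tu sX sX Xk.
by rewrite (minkC (X p)); move: (mink _ _) => x; lra.
Qed.

Lemma mink_diffT_T : mink (diffM M T p u) (T p) = 0.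
Proof. exact: mink_diff_unit vT.1 minkTT. Qed.

(** [Z] is parallel, so [T] and [N = Z - T] have opposite derivatives, and [N]
    has constant square. *)
Lemma mink_diffT_N : mink (diffM M T p u) (N p) = 0.
Proof.
have := mink_diff_unit nN.1 minkNN.
by rewrite diffM_ZN minkNl; move: (mink _ _) => x; lra.
Qed.

Lemma mink_diffW_W : mink (diffM M W p u) (W p) = 0.
Proof. exact: mink_diff_unit vW.1 minkWW. Qed.

Lemma mink_diffW_T : mink (diffM M W p u) (T p) = - mink (diffM M T p u) (W p).
Proof.
by rewrite (diffM_mink_cst M_surface Mp Tu vT.1 vW.1 minkTW) opprK minkC.
Qed.

Lemma mink_diffT_W : mink (diffM M T p u) (W p) = mink (diffM M W p u) (N p).
Proof.
have := diffM_mink_cst M_surface Mp Tu nN.1 vW.1 minkNW.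
rewrite diffM_ZN minkNl (minkC (N p)).
by move: (mink _ _) (mink _ _) => x y; lra.
Qed.

End AlongVector.

Let TT := vT.2 p Mp.
Let TW := vW.2 p Mp.

(** The bracket of [T] and [W] is tangent. *)
Lemma mink_diff_normal n : nfield M n ->
  mink (diffM M T p (W p)) (n p) = mink (diffM M W p (T p)) (n p).
Proof.
move=> [_ nn]; have := nn p Mp _ ((vfield_bracket M_surface M_spacelike nabla_LC vT vW).2 p Mp).
rewrite /bracket minkC minkDl minkNl.
by move: (mink _ _) (mink _ _) => x y; lra.
Qed.

Lemma coef_aE : a = mink (diffM M W p (W p)) (N p).
Proof. exact: mink_sff_nfield. Qed.

Lemma mink_diffTW_N : mink (diffM M W p (T p)) (N p) = 0.
Proof. by rewrite -(mink_diff_normal nN) mink_diffT_N. Qed.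

(** The structure equations of the frame. The derivatives of [T] have no
    [W']-component because they are orthogonal to [N], and the derivative of [T]
    along [T] has no [W]-component because its value there is
    [mink (D_T W) N = mink (D_W T) N = 0]. *)
Lemma diffTT : diffM M T p (T p) = al *: N p.
Proof.
rewrite [LHS](frame_expansion Mp (mink_diffT_T TT) _ (erefl al) (mink_diffT_N TT) (y := 0)).
  by rewrite !scale0r !add0r addr0.
by rewrite mink_diffT_W// mink_diffTW_N.
Qed.

Lemma diffTW : diffM M W p (T p) = be *: N p.
Proof.
rewrite [LHS](frame_expansion Mp _ (mink_diffW_W TT) (erefl be) mink_diffTW_N (x := 0)).
  by rewrite !scale0r !add0r addr0.
by rewrite mink_diffW_T// mink_diffT_W// mink_diffTW_N oppr0.
Qed.

Lemma diffWT : diffM M T p (W p) = be *: N p + a *: W p.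
Proof.
rewrite [LHS](frame_expansion Mp (mink_diffT_T TW) (mink_diffT_W TW)
  (mink_diff_normal nW') (mink_diffT_N TW)).
by rewrite !scale0r add0r addr0 coef_aE addrC.
Qed.

Lemma diffWW : diffM M W p (W p) = - a *: T p + ga *: N p + a *: W' p.
Proof.
rewrite [LHS](frame_expansion Mp _ (mink_diffW_W TW) (erefl ga) (esym coef_aE) (x := - a)).
  by rewrite scale0r addr0.
by rewrite mink_diffW_T// mink_diffT_W// coef_aE.
Qed.

Lemma sff_expansion X Y : vfield M X -> vfield M Y ->
  sff M nabla X Y p = mink (diffM M Y p (X p)) (W' p) *: N p
    + mink (diffM M Y p (X p)) (N p) *: W' p.
Proof.
move=> vX vY; have sn V : vfield M V -> mink (sff M nabla X Y p) (V p) = 0.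
  by move=> vV; exact: (sff_normal M_surface M_spacelike nabla_LC).
have sN n : nfield M n -> mink (sff M nabla X Y p) (n p) = mink (diffM M Y p (X p)) (n p).
  by move=> nn; exact: (mink_sff_nfield nabla_LC).
rewrite [LHS](frame_expansion Mp (sn _ vT) (sn _ vW) (sN _ nW') (sN _ nN)).
by rewrite !scale0r !add0r.
Qed.

Lemma sffTT : sff M nabla T T p = al *: N p.
Proof.
by rewrite (sff_expansion vT vT) (mink_diffT_N TT) [X in _ + X]scale0r addr0.
Qed.

Lemma sffTW : sff M nabla T W p = be *: N p.
Proof.
by rewrite (sff_expansion vT vW) mink_diffTW_N [X in _ + X]scale0r addr0.
Qed.

Lemma sffWW : sff M nabla W W p = ga *: N p + a *: W' p.
Proof. by rewrite (sff_expansion vW vW) coef_aE. Qed.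

Lemma curvKE : curvK M Z nabla W p = al * a.
Proof.
rewrite /curvK /gauss_curvature (gauss_equation M_surface M_spacelike nabla_LC vT vW Mp).
rewrite sffTT sffTW sffWW (minkTT Mp) (minkWW Mp) (minkTW Mp).
have comb (n m : 'rV[R]_4) (x y z k : R) : mink n n = 0 -> mink n m = 1 ->
    (mink (x *: n) (y *: n + k *: m) - mink (z *: n) (z *: n)) / (1 * 1 - 0 ^+ 2) = x * k.
  by move=> nn nm; rewrite !minkE nn nm; field.
exact: comb (minkNN Mp) (minkNW' Mp).
Qed.

Lemma shape_expansion nu : nfield M nu ->
  shape M nabla nu T p = (al * mink (N p) (nu p)) *: T p + (be * mink (N p) (nu p)) *: W p.
Proof.
move=> nnu; have [Tsh shY] := shapeP M_surface M_spacelike nabla_LC vT nnu Mp.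
by rewrite [LHS](tangent_expansion Mp Tsh) (shY _ vT) (shY _ vW) sffTT sffTW !minkZl.
Qed.

Lemma mink_shape2_W nu nu' : nfield M nu -> nfield M nu' ->
  mink (shape M nabla nu' (shape M nabla nu T) p) (W p) =
  mink (N p) (nu p) * (al * be * mink (N p) (nu' p)
    + be * (ga * mink (N p) (nu' p) + a * mink (W' p) (nu' p))).
Proof.
move=> nnu nnu'; have vX := vfield_shape vT nnu.
have [_ shY] := shapeP M_surface M_spacelike nabla_LC vX nnu' Mp.
have DW : diffM M W p (shape M nabla nu T p) =
    (al * mink (N p) (nu p)) *: (be *: N p) +
    (be * mink (N p) (nu p)) *: (- a *: T p + ga *: N p + a *: W' p).
  rewrite (shape_expansion nnu) (diffM_lin M_surface _ _ vW.1 Mp TT TW).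
  by congr (_ *: _ + _ *: _); [exact: diffTW|exact: diffWW].
rewrite shY// (mink_sff_nfield nabla_LC vX vW nnu' Mp) DW.
have Tnu : mink (T p) (nu' p) = 0 by rewrite minkC; exact: nnu'.2.
have comb (t n m v : 'rV[R]_4) (x y b g k l : R) : mink t v = 0 ->
    mink (x * l *: (b *: n) + y * l *: (- k *: t + g *: n + k *: m)) v =
    l * (x * b * mink n v + y * (g * mink n v + k * mink m v)).
  by move=> tv; rewrite !minkE tv; ring.
exact: comb.
Qed.

Lemma curvKNE : curvKN M Z nabla W W' p = - (be * a).
Proof.
rewrite /curvKN minkDl minkNl (mink_shape2_W nfield_e4 nfield_e3).
rewrite (mink_shape2_W nfield_e3 nfield_e4).
rewrite e3E e4E !minkDr !minkZr (minkNN Mp) (minkNW' Mp) (minkW'W' Mp).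
rewrite (minkC (W' p)) (minkNW' Mp).
have : s * s = 1 / 2 by exact: sqrt2Vsq.
move: al be ga a s => x y z k r rr.
transitivity (- (2 * (r * r) * y * k)); first by ring.
by rewrite rr; field.
Qed.

(** Only the components of [dG u] along [N /\ W] and [T /\ W'] contribute; the
    determinant is the oriented volume of the adapted frame. *)
Lemma deltaE x y :
  delta M Z W p (x *: T p + y *: W p) =
  2 * (x * al + y * be) * (y * a) * det4 (T p) (W p) (e3 M Z W' p) (e4 M Z W' p).
Proof.
set u := x *: _ + _.
have Tu : tangent M p u by exact: tangent_lin.
rewrite /delta -[gauss_map M Z W]/(fun q => wedge2 (T q) (W q)).
rewrite (diffM_wedge2 M_surface Mp Tu vT.1 vW.1) /u.
have DT : diffM M T p (x *: T p + y *: W p) =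
    (x * al + y * be) *: N p + (y * a) *: W p.
  rewrite (diffM_lin M_surface _ _ vT.1 Mp TT TW).
  transitivity (x *: (al *: N p) + y *: (be *: N p + a *: W p)).
    by congr (_ *: _ + _ *: _); [exact: diffTT|exact: diffWT].
  have comb (n w : 'rV[R]_4) (b c k : R) :
      x *: (b *: n) + y *: (c *: n + k *: w) = (x * b + y * c) *: n + (y * k) *: w.
    by apply/rowP => i; rewrite !mxE; ring.
  exact: comb.
have DW : diffM M W p (x *: T p + y *: W p) =
    (x * be + y * ga) *: N p + (y * - a) *: T p + (y * a) *: W' p.
  rewrite (diffM_lin M_surface _ _ vW.1 Mp TT TW).
  transitivity (x *: (be *: N p) + y *: (- a *: T p + ga *: N p + a *: W' p)).
    by congr (_ *: _ + _ *: _); [exact: diffTW|exact: diffWW].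
  have comb (t n m : 'rV[R]_4) (b c k : R) :
      x *: (b *: n) + y *: (- k *: t + c *: n + k *: m) =
      (x * b + y * c) *: n + (y * - k) *: t + (y * k) *: m.
    by apply/rowP => i; rewrite !mxE; ring.
  exact: comb.
by rewrite DT DW wedge4_square wedge4_swap -wedge4_wedge2 wedge2_e3e4 wedge4Nr.
Qed.

End StructureEquations.
End CanonicalNullFrame.

(** * Asymptotic directions *)

Theorem proposition2p13 (R : realType) (M : set 'rV[R]_4) (Z : 'rV[R]_4)
    (nabla : ('rV[R]_4 -> 'rV[R]_4) -> ('rV[R]_4 -> 'rV[R]_4) ->
             ('rV[R]_4 -> 'rV[R]_4))
    (W W' : 'rV[R]_4 -> 'rV[R]_4) (p : 'rV[R]_4)
    (M_surface : regular_surface M) (M_spacelike : spacelike M)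
    (Z_unit : mink Z Z = 1) (Z_null : canonical_normal_null M Z)
    (nabla_LC : levi_civita M nabla) (WW'_frame : adapted_frame M Z W W')
    (Mp : M p) :
  let a := coef_a M Z nabla W p in
  let K := curvK M Z nabla W p in
  let KN := curvKN M Z nabla W W' p in
  let T := ZT M Z p in
  let V := (KN / K) *: T + W p in
  [/\ a <> 0 -> K <> 0 ->
        [/\ asymptotic M Z W p T, asymptotic M Z W p V,
            ~ same_direction T V
          & forall u, asymptotic M Z W p u ->
              same_direction T u \/ same_direction V u],
      a <> 0 -> K = 0 -> double_asymptotic M Z W p
    & a = 0 -> forall u, tangent M p u -> u != 0 -> asymptotic M Z W p u].
Proof.
move=> a K KN T V.
(* Field identities, kept apart from the geometric terms they are used on. *)
have slopeE (x y z : R) : x != 0 -> z != 0 -> - (y * z) / (x * z) = - (y / x).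
  by move=> x0 z0; field; rewrite x0 z0.
have root0 (x y z k : R) : x != 0 -> 2 * (- (y / x) * x + 1 * y) * (1 * z) * k = 0.
  by move=> x0; field.
have xE (x y al be : R) : al != 0 -> x * al + y * be = 0 -> x = y * - (be / al).
  by move=> al0 /eqP; rewrite addr_eq0 => /eqP e; rewrite -[x](mulfK al0) e; field.
have KE : K = _ * a := curvKE M_surface M_spacelike Z_unit Z_null nabla_LC WW'_frame Mp.
have KNE : KN = - (_ * a) :=
  curvKNE M_surface M_spacelike Z_unit Z_null nabla_LC WW'_frame Mp.
have dE x y : delta M Z W p (x *: T + y *: W p) = 2 * (x * _ + y * _) * (y * a) * _ :=
  deltaE M_surface M_spacelike Z_unit Z_null nabla_LC WW'_frame Mp x y.
have vol0 := lt0r_neq0 (af_pos WW'_frame Mp).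
have TT := minkTT M_surface M_spacelike Z_unit Z_null Mp.
have TW := minkTW WW'_frame Mp.
have WW := minkWW WW'_frame Mp.
have Texp u : tangent M p u -> exists x y, u = x *: T + y *: W p.
  move=> Tu; exists (mink u T), (mink u (W p)).
  exact: (tangent_expansion M_surface M_spacelike Z_unit Z_null WW'_frame Mp Tu).
have tanT : tangent M p T := (vfield_ZT Z M_surface M_spacelike).2 p Mp.
have tanW : tangent M p (W p) := (af_W WW'_frame).2 p Mp.
have double : asymptotic M Z W p T -> (exists c : R, forall r k : R,
    delta M Z W p (r *: T + k *: W p) = c * k ^+ 2) -> double_asymptotic M Z W p.
  by split.
(* From here on the proof is about the form (x * al + y * be) * (y * a): the
   geometric quantities become variables. *)
move: KE KNE dE vol0 TT TW.
rewrite -/T.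
move: (mink _ (W' p)) (mink _ (W' p)) (det4 _ _ _ _).
move=> be al vol KE KNE dE vol0 TT TW.
clearbody a K KN T.
have V0 (x : R) : mink (x *: T + W p) (W p) = 1.
  by rewrite minkDl minkZl TW WW mulr0 add0r.
have T0 : T != 0.
  by apply/eqP => T0; move: TT; rewrite T0 mink0l => /eqP; rewrite eq_sym oner_eq0.
have asymT : asymptotic M Z W p T.
  split=> //; have := dE 1 0.
  by rewrite scale1r scale0r addr0 => ->; ring.
split.
- move=> /eqP a0 /eqP K0.
  have al0 : al != 0 by apply: contraNneq K0 => al0; rewrite KE al0 mul0r.
  have slope : KN / K = - (be / al).
    by rewrite KNE KE; exact: (slopeE _ _ _ al0 a0).
  split; first exact: asymT.
  + split.
    - by rewrite /V -[W p]scale1r; exact: tangent_lin.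
    - apply/eqP => V00; have := V0 (KN / K).
      by rewrite -/V V00 mink0l => /eqP; rewrite eq_sym oner_eq0.
    - rewrite /V -[X in _ + X]scale1r dE slope.
      exact: (root0 _ _ _ _ al0).
  + move=> [c _ VcT]; have := V0 (KN / K).
    by rewrite -/V VcT minkZl TW mulr0 => /eqP; rewrite eq_sym oner_eq0.
  + move=> u [Tu u0 du]; have [x [y uE]] := Texp u Tu.
    move: du; rewrite uE dE => /eqP; rewrite !mulf_eq0 (negPf vol0) (negPf a0).
    rewrite pnatr_eq0 /= !orbF => /orP[/eqP xy|/eqP y0].
      right; exists y; last first.
        rewrite /V scalerDr scalerA slope; congr (_ *: _ + _).
        exact: (xE _ _ _ _ al0 xy).
      apply: contra_neq u0 => y0; rewrite uE y0 scale0r addr0.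
      move: xy; rewrite y0 mul0r addr0 => /eqP; rewrite mulf_eq0 (negPf al0) orbF.
      by move=> /eqP->; rewrite scale0r.
    left; exists x; last by rewrite y0 scale0r addr0.
    by apply: contra_neq u0 => x0; rewrite uE x0 y0 !scale0r addr0.
- move=> /eqP a0 K0; have al0 : al = 0.
    by move: KE => /esym/eqP; rewrite K0 mulf_eq0 (negPf a0) orbF => /eqP.
  apply: double asymT _; exists (2 * be * a * vol) => x y.
  by rewrite dE al0; ring.
- move=> a0 u Tu u0; split=> //; have [x [y ->]] := Texp u Tu.
  by rewrite dE a0 !mulr0 mul0r.
Qed.
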